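(* Suppose a group $G$, which is not virtually cyclic, acts on a $\delta$-hyperbolic space $X$. Let $D(\epsilon)$ be a function for WPD. Assume that there exists a constant $M$ such that for any finite generating set $S$ of $G$, the set $S^M$ contains a hyperbolic element $h$ that is $D$-WPD. Set $$A=\frac{1}{79220\,M\,(D(200\delta))^3}>0.$$ Then for any finite generating set $S$ of $G$, we have $e(G,S)\ge A|S|^A$.
   Context: Conventions. Groups act by isometries; $\delta>0$. A $\delta$-hyperbolic space is a geodesic space that is $\delta$-hyperbolic in the sense of Gromov; by the paper's convention it is taken to be a connected graph with unit-length edges, acted on by graph automorphisms, so that infima such as $L(g)$ below are attained. Distance is written $|x-y|$. Growth. Generating sets are always symmetric, $S=S^{-1}$. $S^n=B_n(G,S)$ is the set of elements of $G$ of word length at most $n$ with respect to $S$, and $e(G,S)=\lim_{n\to\infty}|B_n(G,S)|^{1/n}$. Hyperbolic isometries and axes. For $g\in G$ put $L(g)=\inf_{x\in X}|x-g(x)|$ and $\lambda(g)=\lim_{n\to\infty}|x-g^n(x)|/n$ (independent of $x$). The element $g$ is hyperbolic (on $X$) if $\lambda(g)>0$. A $10\delta$-axis of a hyperbolic $g$ is the bi-infinite path obtained as follows: if $L(g)\ge10\delta$, take a point $x$ where $L(g)$ is attained and let the axis be the union of the $\langle g\rangle$-translates of a geodesic $[x,g(x)]$; if $L(g)<10\delta$, take $n>0$ with $L(g^n)\ge10\delta$ and apply this construction to $g^n$. For any two points $x,y$ on a $10\delta$-axis, the Hausdorff distance between the part of the axis between $x,y$ and a geodesic $[x,y]$ is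 at most $10\delta$. WPD. A function for WPD is a function $D$ assigning to each $\epsilon>0$ a number $D(\epsilon)>0$, assumed without loss of generality to be non-decreasing and to satisfy $D(100\delta)\ge50$. A hyperbolic element $g\in G$ is $D$-WPD if there is a $10\delta$-axis $\gamma$ of $g$ such that for any $\epsilon>0$ and any $x,y\in\gamma$ with $|x-y|\ge D(\epsilon)\lambda(g)$, the set $\{h\in G : |h(x)-x|\le\epsilon,\ |h(y)-y|\le\epsilon\}$ has at most $D(\epsilon)$ elements. *)

(* Defs.v *)
From HB Require Import structures.
From mathcomp Require Import all_boot all_order all_algebra finmap.
From mathcomp Require Import all_classical all_reals all_analysis.
Import Order.TTheory GRing.Theory Num.Theory.
Import numFieldNormedType.Exports.

Set Implicit Arguments.
Unset Strict Implicit.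
Unset Printing Implicit Defensive.

Local Open Scope classical_set_scope.
Local Open Scope ring_scope.

Section Groups.
Context {G : groupType}.

Definition gexpz (g : G) (k : int) : G :=
  match k with Posz n => (g ^+ n)%g | Negz n => (g ^- n.+1)%g end.

Definition cyclic_subgroup (g : G) : set G := range (gexpz g).

Definition finite_index (H : set G) : Prop :=
  finite_set (range (fun g : G => [set (g * h)%g | h in H])).

Definition virtually_cyclic : Prop :=
  exists g : G, finite_index (cyclic_subgroup g).


Definition word_ball (S : {fset G}) (n : nat) : set G :=
  [set g | exists w : seq G,
    [/\ (size w <= n)%N, {subset w <= S} & (\prod_(s <- w) s)%g = g]].

Definition generating (S : {fset G}) : Prop :=
  (forall s, s \in S -> (s^-1)%g \in S) /\
  (forall g : G, exists n, word_ball S n g).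

End Groups.
Arguments virtually_cyclic G : clear implicits.

Definition growth_rate (R : realType) (G : groupType) (S : {fset G}) : R :=
  limn (fun n => #|` fset_set (word_ball S n)|%:R `^ n%:R^-1).

(* Graphs in the sense of Serre: every geometric edge is a pair {e, rev e} of
   oriented edges.  Loops and multiple edges are allowed. *)
Record graph := Graph {
  vertex : Type;
  edge : Type;
  src : edge -> vertex;
  rev_edge : edge -> edge;
  rev_edgeK : forall e, rev_edge (rev_edge e) = e;
  rev_edge_neq : forall e, rev_edge e <> e }.

Section Graphs.
Variable Gam : graph.

Definition tgt (e : edge Gam) : vertex Gam := src (rev_edge e).

Inductive walk : nat -> vertex Gam -> vertex Gam -> Prop :=
| Walk0 u : walk 0 u u
| WalkS n e v of walk n (tgt e) v : walk n.+1 (src e) v.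

Definition connected_graph : Prop :=
  inhabited (vertex Gam) /\ forall u v, exists n, walk n u v.

Definition graph_automorphism
    (fV : vertex Gam -> vertex Gam) (fE : edge Gam -> edge Gam) : Prop :=
  [/\ bijective fV, bijective fE,
      forall e, src (fE e) = fV (src e) &
      forall e, rev_edge (fE e) = fE (rev_edge e)].

Context {R : realType}.

(* EdgePoint e t is the point of e at distance t from src e along e; points of
   the realization have several such codes, which rdist puts at distance 0. *)
Inductive graph_point := VertexPoint of vertex Gam | EdgePoint of edge Gam & R.

Definition valid_point (p : graph_point) : Prop :=
  if p is EdgePoint _ t then 0 <= t <= 1 else True.

(* The vertices reachable from p inside its edge, with the length needed. *)
Definition exits (p : graph_point) : set (vertex Gam * R) :=
  match p with
  | VertexPoint v => [set (v, 0)]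
  | EdgePoint e t => [set (src e, t); (tgt e, 1 - t)]
  end.

Definition inner_lengths (p q : graph_point) : set R :=
  match p, q with
  | EdgePoint e s, EdgePoint f t =>
      [set l | f = e /\ l = `|s - t| \/ f = rev_edge e /\ l = `|s - (1 - t)|]
  | _, _ => set0
  end.

Definition path_lengths (p q : graph_point) : set R :=
  inner_lengths p q `|`
  [set l | exists a b n, [/\ exits p a, exits q b, walk n a.1 b.1 &
                             l = a.2 + n%:R + b.2]].

Definition rdist (p q : graph_point) : R := inf (path_lengths p q).

Definition map_point (fV : vertex Gam -> vertex Gam)
    (fE : edge Gam -> edge Gam) (p : graph_point) : graph_point :=
  match p with
  | VertexPoint v => VertexPoint (fV v)
  | EdgePoint e t => EdgePoint (fE e) t
  end.

End Graphs.
Arguments graph_point : clear implicits.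

Section Geometry.
Context {R : realType} {X : metricType R}.

Definition geodesic (x y : X) (c : R -> X) : Prop :=
  [/\ c 0 = x, c (mdist x y) = y &
      {in `[0, mdist x y] &, forall s t, mdist (c s) (c t) = `|s - t|}].

Definition geodesic_space : Prop := forall x y : X, exists c, geodesic x y c.

Definition gromov_product (w x y : X) : R :=
  (mdist x w + mdist y w - mdist x y) / 2.

Definition hyperbolic_space (delta : R) : Prop :=
  geodesic_space /\
  forall w x y z : X,
    Num.min (gromov_product w x y) (gromov_product w y z) - delta
      <= gromov_product w x z.

Context {G : groupType}.
Variable act : G -> X -> X.

Definition isometric_action : Prop :=
  [/\ forall x, act 1%g x = x,
      forall g h x, act (g * h)%g x = act g (act h x) &
      forall g x y, mdist (act g x) (act g y) = mdist x y].

(* X is the geometric realization (phi is the quotient map from codes to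
   points) of a connected graph, and G acts through graph automorphisms. *)
Definition acts_on_graph : Prop :=
  exists (Gam : graph) (phi : graph_point Gam R -> X),
  [/\ connected_graph Gam,
      forall x, exists2 p, valid_point p & phi p = x,
      forall p q, valid_point p -> valid_point q ->
        mdist (phi p) (phi q) = rdist p q &
      forall g, exists fV fE, graph_automorphism fV fE /\
        forall p, valid_point p -> act g (phi p) = phi (map_point fV fE p)].

Definition displacement (g : G) : R := inf (range (fun x => mdist x (act g x))).

Definition translation_length (g : G) : R :=
  get [set l : R | forall x,
    (fun n : nat => mdist x (act (g ^+ n)%g x) / n%:R) @ \oo --> l].

Definition hyperbolic_elt (g : G) : Prop := 0 < translation_length g.

Definition translates_axis (g : G) (gam : set X) : Prop :=
  exists (x : X) (c : R -> X),
  [/\ mdist x (act g x) = displacement g, geodesic x (act g x) c &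
      gam = \bigcup_(k in [set: int])
              [set act (gexpz g k) (c t) | t in `[0, mdist x (act g x)]]].

Definition is_axis (delta : R) (g : G) (gam : set X) : Prop :=
  if 10 * delta <= displacement g then translates_axis g gam
  else exists n : nat, [/\ (0 < n)%N, 10 * delta <= displacement (g ^+ n)%g &
                           translates_axis (g ^+ n)%g gam].

Definition wpd (delta : R) (D : R -> R) (g : G) : Prop :=
  hyperbolic_elt g /\
  exists2 gam, is_axis delta g gam &
    forall (eps : R) (x y : X), 0 < eps -> gam x -> gam y ->
      D eps * translation_length g <= mdist x y ->
      let F := [set h : G | mdist (act h x) x <= eps /\
                            mdist (act h y) y <= eps] in
      finite_set F /\ #|` fset_set F|%:R <= D eps.

End Geometry.
Arguments hyperbolic_space {R} X delta.
Arguments geodesic_space {R} X.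

Definition wpd_function (R : realType) (delta : R) (D : R -> R) : Prop :=
  [/\ forall eps, 0 < eps -> 0 < D eps,
      forall eps eps', 0 < eps -> eps <= eps' -> D eps <= D eps' &
      50 <= D (100 * delta)].

(* Main.v *)
(** Let [h] be the WPD element given by a generating set [S]. Busemann functions at the two
    ends of its axis, taken along an ultrafilter, give each point of the space a coordinate
    along the axis and a height above it, up to a few [delta]. If the axis and its translate
    by [t] overlap on a length [5 * D(200 delta) * lambda(h)], then WPD and a pigeonhole
    argument force [t] to normalize a power of [h] up to inversion. Such [t] form a subgroup
    [E], which is proper since otherwise the group would be virtually cyclic, and WPD bounds
    the intersection of [E] with a different conjugate of itself. Hence about
    [(|S| / D)^(1/2)] elements [t] of [S^3] lie in distinct cosets [t E], and their translated
    axes pairwise have small overlaps.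

    Order these axes by their distance to a base point, and let [N] be about [1000 D]. Either
    there are about [(|S| / D)^(1/4)] axes none of which separates the base point from another
    one, and the conjugates [t h^N t^-1] play ping-pong; or as many axes are followed in turn by
    a single geodesic, and products of two conjugates do, seen from the middle of one of the
    first axes. In both cases the group contains a free semigroup whose number of generators is
    about [(|S| / D)^(1/4)] and whose generators have length at most [12 + 2 M N]. *)

Require Import Defs.
From mathcomp Require Import all_boot all_order all_algebra finmap.
From mathcomp Require Import all_classical all_reals all_analysis.
From mathcomp Require Import zify ring lra.
Import Order.TTheory GRing.Theory Num.Theory.
Import numFieldNormedType.Exports.

Set Implicit Arguments.
Unset Strict Implicit.
Unset Printing Implicit Defensive.

Local Open Scope classical_set_scope.
Local Open Scope ring_scope.

(** * Gromov products and chains of translates *)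

(** The main obstacle is that [lambda(h)] may be tiny compared with [delta], and that the axis is
    built from a power of [h] whose exponent is not controlled. So lengths along the axis are
    measured by a coordinate that every [h ^ n] shifts by [n * lambda(h)] up to [2 * delta],
    uniformly in [n]. WPD itself then gives [180 * delta <= D(200 delta) * lambda(h)], so that
    overlaps and the shift [N * lambda(h)] dominate all errors in [delta]. The two square roots have
    different causes. If [S] meets few cosets of [E], some coset [t E] contains many [g] of [S]; for
    a generator [c] outside [E] the elements [t^-1 g c] have length 3, and few of them share a
    coset. Next, the relation of separating another axis from the base point, directed by the
    distance to that point, has a kernel: either it is large, or one of its members lies behind many
    axes, which a single geodesic then follows in turn. *)

Lemma normr_cases (R : realDomainType) (a : R) :
  (0 <= a /\ `|a| = a) \/ (a <= 0 /\ `|a| = - a).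
Proof.
by case: (lerP 0 a) => [a0|/ltW a0]; [left; rewrite ger0_norm|right; rewrite ler0_norm].
Qed.

Section FourPoint.
Context {R : realType} {X : metricType R}.

(** A disjunction instead of a maximum, so that linear arithmetic can refute one case and use the
    other. *)
Definition four_point (delta : R) := forall x y z w : X,
  mdist x z + mdist y w <= mdist x y + mdist z w + 2 * delta \/
  mdist x z + mdist y w <= mdist y z + mdist x w + 2 * delta.

Lemma hyperbolic_four_point delta : hyperbolic_space X delta -> four_point delta.
Proof.
move=> [_ H] x y z w; have := H w x y z; rewrite /gromov_product.
by rewrite lerBlDr ge_min => /orP[] ?; [left|right]; lra.
Qed.

Lemma gp_min delta : four_point delta -> forall w x y z : X,
  gromov_product w x y - delta <= gromov_product w x z \/
  gromov_product w y z - delta <= gromov_product w x z.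
Proof.
move=> H w x y z; rewrite /gromov_product.
by case: (H x y z w) => ?; [left|right]; lra.
Qed.

Lemma gpC (w x y : X) : gromov_product w x y = gromov_product w y x.
Proof. by rewrite /gromov_product (metric_sym x y); lra. Qed.

Lemma gpK (w x y : X) : gromov_product w x y = mdist x w - gromov_product x w y.
Proof. by rewrite /gromov_product (metric_sym w x) (metric_sym y x) (metric_sym w y); lra. Qed.

Lemma gp_xx (w x : X) : gromov_product w x x = mdist x w.
Proof. by rewrite /gromov_product mdistxx; lra. Qed.

End FourPoint.

Section Chain.
Context {R : realType} {X : metricType R} (delta : R) (z : nat -> X).
Hypothesis delta0 : 0 < delta.
Hypothesis H4 : @four_point R X delta.
Hypothesis zS : forall i j, mdist (z i.+1) (z j.+1) = mdist (z i) (z j).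
Local Notation L := (mdist (z 0%N) (z 1%N)).
Hypothesis L10 : 10 * delta <= L.
Hypothesis turn : 2 * L - 4 * delta <= mdist (z 0%N) (z 2%N).

Local Ltac slra := move: (delta0) (L10) (turn); lra.

Lemma chain_shift i k : mdist (z i) (z (i + k)%N) = mdist (z 0%N) (z k).
Proof. by elim: i => [//|i IH]; rewrite addSn zS. Qed.

Lemma chain_shiftB i j : (i <= j)%N -> mdist (z i) (z j) = mdist (z 0%N) (z (j - i)%N).
Proof. by move=> ij; rewrite -(chain_shift i) subnKC. Qed.

(** Four-point inequality for [z 0], [z k], [z k.+1], [z k.+2]. By induction the first alternative
    would give [2 * L <= 12 * delta], against [L10]; the second one is the claim, with the same loss
    [4 * delta + 2 * delta] at every step. *)
Lemma chain_step k :
  mdist (z 0%N) (z k) + L - 6 * delta <= mdist (z 0%N) (z k.+1).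
Proof.
elim: k => [|k IH]; first by rewrite mdistxx; slra.
have := H4 (z 0%N) (z k) (z k.+1) (z k.+2).
rewrite (@chain_shiftB k k.+2) ?(@chain_shiftB k.+1 k.+2) ?(@chain_shiftB k k.+1); [|lia..].
have -> : (k.+2 - k = 2)%N by lia.
have -> : (k.+2 - k.+1 = 1)%N by lia.
have -> : (k.+1 - k = 1)%N by lia.
slra.
Qed.

(** The loss is independent of [a] and [b], which summing [chain_step] would not give: the
    four-point inequality is applied once, at the junction. *)
Lemma chain_add a b :
  mdist (z 0%N) (z a) + mdist (z 0%N) (z b) - 8 * delta <= mdist (z 0%N) (z (a + b)%N).
Proof.
case: b => [|b]; first by rewrite addn0 mdistxx; slra.
have := H4 (z 0%N) (z a) (z a.+1) (z (a + b.+1)%N).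
rewrite chain_shift addnS -addSn chain_shift.
rewrite (@chain_shiftB a a.+1) //; have -> : (a.+1 - a = 1)%N by lia.
have := chain_step a; have := chain_step b.
slra.
Qed.

(** [7 * delta] is half of the losses [8 * delta] of [chain_add] and [6 * delta] of [chain_step]. *)
Lemma chain_near i m p : (i < m)%N -> mdist (z i) p + mdist p (z i.+1) <= L ->
  gromov_product p (z 0%N) (z m) <= 7 * delta.
Proof.
move=> im pL; rewrite /gromov_product.
have := metric_triangle (z 0%N) (z i) p; have := metric_triangle (z m) (z i.+1) p.
rewrite (metric_sym (z m) (z i.+1)) (@chain_shiftB i.+1 m) // (metric_sym (z i.+1) p).
have := chain_add i (m - i)%N; rewrite subnKC ?(ltnW im) //.
have := chain_step (m - i.+1)%N; have -> : ((m - i.+1).+1 = m - i)%N by lia.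
slra.
Qed.

Lemma chain_far m : 4 * delta * m%:R <= mdist (z 0%N) (z m).
Proof.
elim: m => [|m IH]; first by rewrite mulr0 mdistxx.
by have := chain_step m; rewrite -(natr1 m) => ?; slra.
Qed.

End Chain.

(** * Coordinates along a line *)

Section Ultra.
Context {R : realType} (U : set_system nat) {UU : UltraFilter U}.

(** Busemann functions along a chain need not converge; one ultrafilter provides their limits at all
    points at once, compatibly with sums. *)
Lemma ultra_cvg (v : nat -> R) (B : R) : (forall n, `|v n| <= B) -> {l : R | v @ U --> l}.
Proof.
move=> vB; apply: cid.
have := @segment_compact R (- B) B; rewrite compact_ultra /=.
move=> /(_ (v @ U)) [].
- split=> [|G GF sub].
    by apply: fmap_proper_filter.
  rewrite predeqE => A; split=> [GA|vA]; last exact: (sub _ vA).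
  case: (in_ultra_setVsetC (v @^-1` A) UU) => // UA.
  have GA' : G (~` A) by exact: (sub _ UA).
  have : G (A `&` ~` A) by exact: filterI.
  by rewrite setICr => /filter_not_empty.
- by apply: (@filterE _ U) => n; rewrite /= in_itv /= -ler_norml.
- by move=> l [_ ?]; exists l.
Qed.

End Ultra.

(* [x] and [y] behave like the coordinate along a bi-infinite geodesic and the
   distance to it. *)
Record line_coordinates (R : realType) (X : metricType R) (delta : R) (x y : X -> R)
  : Prop := LineCoordinates {
  line_upper : forall p q, mdist p q <= `|x p - x q| + y p + y q + 2 * delta;
  line_lower : forall p q, `|x p - x q| <= delta \/
    `|x p - x q| + y p + y q - 2 * delta <= mdist p q;
  line_lipx : forall p q, `|x p - x q| <= mdist p q;
  line_lipy : forall p q, `|y p - y q| <= mdist p q;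
  line_ge0 : forall p, 0 <= y p }.

Section Line.
Context {R : realType} {X : metricType R} (delta : R) (o : X) (a b : nat -> X) (C0 : R).
Hypothesis delta0 : 0 < delta.
Hypothesis H4 : @four_point R X delta.
Hypothesis a_far : forall M : R, \forall n \near \oo, M <= mdist o (a n).
Hypothesis b_far : forall M : R, \forall n \near \oo, M <= mdist o (b n).
Hypothesis ab_gp : forall n, gromov_product o (a n) (b n) <= C0.

(** [x] is half the difference of the Busemann functions at the two ends; [y] is half their sum,
    normalized to be the limit of the Gromov products of [a n] and [b n], hence nearly the distance
    to the line. The last clause holds because an isometry moving the two sequences by a bounded
    amount fixes both ends. *)
Lemma exists_line_coordinates : exists x y : X -> R,
  [/\ line_coordinates delta x y,
   (forall p c, (\forall n \near \oo, gromov_product p (a n) (b n) <= c) -> y p <= c),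
   (forall p q c, (\forall n \near \oo, c <= mdist q (a n) - mdist p (a n) /\
                     c <= mdist p (b n) - mdist q (b n)) -> c <= x q - x p) &
   (forall r r' : X -> X, cancel r r' -> cancel r' r ->
      (forall p q, mdist (r p) (r q) = mdist p q) ->
      (exists C, forall n, mdist (r (a n)) (a n) <= C /\ mdist (r (b n)) (b n) <= C) ->
      forall p q, `|(x (r p) - x p) - (x (r q) - x q)| <= 2 * delta /\
                  `|y (r p) - y p| <= 2 * delta)].
Proof.
have [U [UU subU]] := @ultraFilterLemma nat \oo _.
have PU : ProperFilter U by exact: ultra_proper.
have busemann (c : nat -> X) (p : X) :
    {l : R | (fun n => mdist p (c n) - mdist o (c n)) @ U --> l}.
  apply: (@ultra_cvg _ _ _ _ (mdist p o)) => n; rewrite ler_norml.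
  have := metric_triangle p o (c n); have := metric_triangle o p (c n).
  by rewrite (metric_sym o p); lra.
have [kap kapP] : {l : R | (fun n => gromov_product o (a n) (b n)) @ U --> l}.
  apply: (@ultra_cvg _ _ _ _ C0) => n; rewrite ler_norml ab_gp andbT.
  have := ab_gp n; rewrite /gromov_product.
  have := metric_triangle (a n) o (b n); rewrite (metric_sym o (b n)); lra.
pose bm p := projT1 (busemann a p); pose bp p := projT1 (busemann b p).
have bmP p : (fun n => mdist p (a n) - mdist o (a n)) @ U --> bm p := projT2 (busemann a p).
have bpP p : (fun n => mdist p (b n) - mdist o (b n)) @ U --> bp p := projT2 (busemann b p).
pose x p := (bm p - bp p) / 2; pose y p := (bm p + bp p) / 2 + kap.
pose xs p n := (mdist p (a n) - mdist o (a n) - (mdist p (b n) - mdist o (b n))) / 2.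
pose ys p n := gromov_product p (a n) (b n).
have xsP p : xs p @ U --> x p by apply: cvgMl; apply: cvgB.
have ysP p : ys p @ U --> y p.
  have -> : ys p = fun n => (mdist p (a n) - mdist o (a n) + (mdist p (b n) - mdist o (b n))) / 2
       + gromov_product o (a n) (b n).
    apply/funext => n; rewrite /ys /gromov_product.
    by rewrite !(metric_sym _ p) !(metric_sym _ o); lra.
  by apply: cvgD => //; apply: cvgMl; apply: cvgD.
(* Inequalities between limits are checked at a single index [n], good up to [e] for finitely many
   points. *)
have appr (s : seq X) (P : set nat) e : 0 < e -> (\forall n \near \oo, P n) ->
    exists2 n, P n & forall p, p \in s -> [/\ xs p n - e <= x p, x p <= xs p n + e,
                                   ys p n - e <= y p & y p <= ys p n + e].
  move=> e0 nP.
  suff : \forall n \near U, P n /\ forall p, p \in s -> [/\ xs p n - e <= x p, x p <= xs p n + e,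
                                   ys p n - e <= y p & y p <= ys p n + e].
    by move=> /filter_ex[n [? ?]]; exists n.
  apply: filterI; first exact: subU.
  elim: s => [|p s IH]; first exact: filterE.
  near=> n => q; rewrite inE => /orP[/eqP ->|]; last by move: q; near: n.
  have : `|x p - xs p n| < e by near: n; exact: cvgr_dist_lt.
  have : `|y p - ys p n| < e by near: n; exact: cvgr_dist_lt.
  by rewrite !ltr_norml; split; lra.
have a_far' p M : \forall n \near \oo, M <= mdist p (a n).
  apply: filterS (a_far (M + mdist o p)) => n.
  by have := metric_triangle o p (a n); lra.
have b_far' p M : \forall n \near \oo, M <= mdist p (b n).
  apply: filterS (b_far (M + mdist o p)) => n.
  by have := metric_triangle o p (b n); lra.
(* The second alternative of the four-point inequality means [x p - x q <= delta] up to errors below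
   [e], hence the strict hypothesis. *)
have lowerP p q e : 0 < e -> e < x p - x q - delta ->
    x p - x q + y p + y q - 2 * delta - 4 * e <= mdist p q.
  move=> e0 eD; have e1 : 0 < e / 4 by lra.
  have [n _ H] := appr [:: p; q] setT (e / 4) e1 (filterE _ (fun _ => I)).
  case: (H p); rewrite ?inE ?eqxx ?orbT //.
  case: (H q); rewrite ?inE ?eqxx ?orbT //.
  have := H4 p q (a n) (b n).
  rewrite /xs /ys /gromov_product !(metric_sym (a n)) !(metric_sym (b n)) .
  by rewrite (metric_sym (a n) (b n)); lra.
exists x, y; split.
- split.
  + move=> p q; apply/ler_addgt0Pr => e e0; have e1 : 0 < e / 6 by lra.
    have [n _ H] := appr [:: p; q] setT (e / 6) e1 (filterE _ (fun _ => I)).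
    case: (H p); rewrite ?inE ?eqxx ?orbT //.
    case: (H q); rewrite ?inE ?eqxx ?orbT //.
    have := H4 p (a n) q (b n); have := ler_norm (x p - x q).
    have := ler_norm (x q - x p); rewrite distrC.
    rewrite /xs /ys /gromov_product !(metric_sym (a n)) !(metric_sym (b n)) .
    by rewrite (metric_sym (a n) (b n)); lra.
  + move=> p q; case: (lerP `|x p - x q| delta) => H; [by left|right].
    apply/ler_addgt0Pr => e e0.
    have [[_ E]|[_ E]] := normr_cases (x p - x q); rewrite E in H *.
      pose f := Num.min (e / 4) ((x p - x q - delta) / 2).
      have f0 : 0 < f by rewrite /f lt_min; lra.
      have : f <= e / 4 by rewrite /f ge_min lexx.
      have : f <= (x p - x q - delta) / 2 by rewrite /f ge_min lexx orbT.
      by move=> ? ?; have := lowerP p q f f0; lra.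
    pose f := Num.min (e / 4) ((x q - x p - delta) / 2).
    have f0 : 0 < f by rewrite /f lt_min; lra.
    have : f <= e / 4 by rewrite /f ge_min lexx.
    have : f <= (x q - x p - delta) / 2 by rewrite /f ge_min lexx orbT.
    by move=> ? ?; have := lowerP q p f f0; rewrite (metric_sym q p); lra.
  + move=> p q; apply/ler_addgt0Pr => e e0; have e1 : 0 < e / 2 by lra.
    have [n _ H] := appr [:: p; q] setT (e / 2) e1 (filterE _ (fun _ => I)).
    case: (H p); rewrite ?inE ?eqxx ?orbT //.
    case: (H q); rewrite ?inE ?eqxx ?orbT //.
    have := metric_triangle p q (a n); have := metric_triangle p q (b n).
    have := metric_triangle q p (a n); have := metric_triangle q p (b n).
    by rewrite (metric_sym q p) ler_norml /xs; lra.
  + move=> p q; apply/ler_addgt0Pr => e e0; have e1 : 0 < e / 2 by lra.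
    have [n _ H] := appr [:: p; q] setT (e / 2) e1 (filterE _ (fun _ => I)).
    case: (H p); rewrite ?inE ?eqxx ?orbT //.
    case: (H q); rewrite ?inE ?eqxx ?orbT //.
    have := metric_triangle p q (a n); have := metric_triangle p q (b n).
    have := metric_triangle q p (a n); have := metric_triangle q p (b n).
    rewrite /ys /gromov_product !(metric_sym (a n)) !(metric_sym (b n)) .
    by rewrite (metric_sym q p) ler_norml; lra.
  + move=> p; apply/ler_addgt0Pr => e e0.
    have [n _ H] := appr [:: p] setT e e0 (filterE _ (fun _ => I)).
    case: (H p); rewrite ?inE ?eqxx ?orbT //.
    have := metric_triangle (a n) p (b n).
    by rewrite /ys /gromov_product (metric_sym p (b n)); lra.
- move=> p c pc; apply/ler_addgt0Pr => e e0.
  have [n + H] := appr [:: p] _ e e0 pc.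
  by case: (H p); rewrite ?inE ?eqxx ?orbT // /ys; lra.
- move=> p q c pqc; apply/ler_addgt0Pr => e e0; have e1 : 0 < e / 2 by lra.
  have [n + H] := appr [:: p; q] _ (e / 2) e1 pqc.
  case: (H p); rewrite ?inE ?eqxx ?orbT //.
  case: (H q); rewrite ?inE ?eqxx ?orbT //.
  by rewrite /xs; lra.
- have shift1 (r : X -> X) : (forall p q, mdist (r p) (r q) = mdist p q) ->
      (exists C, forall n, mdist (r (a n)) (a n) <= C /\ mdist (r (b n)) (b n) <= C) ->
      forall p q, (x (r p) - x p) - (x (r q) - x q) <= 2 * delta /\
                  y (r p) - y p <= 2 * delta.
    move=> iso [C HC] p q.
    have C_ge0 : 0 <= C by have [+ _] := HC 0%N; have := mdist_ge0 (r (a 0%N)) (a 0%N); lra.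
    (* When [c] is far away, the alternative that pairs [r u] with [r v] and [c] with [r c] is
       impossible; the other one compares the two changes of distance. *)
    have sh c u v : mdist (r c) c <= C -> mdist u v + C + delta + 1 <= mdist u c ->
        (mdist (r u) c - mdist u c) - (mdist (r v) c - mdist v c) <= 2 * delta.
      move=> rc uc; have := H4 (r u) (r v) c (r c); rewrite !iso (metric_sym c (r c)).
      have := metric_triangle u v c; have := metric_triangle (r u) c (r c).
      by rewrite iso (metric_sym c (r c)); have := delta0; lra.
    split.
      apply/ler_addgt0Pr => e e0; have e1 : 0 < e / 4 by lra.
      pose T := 2 * mdist p q + C + delta + 1.
      have nP : \forall n \near \oo, T <= mdist p (a n) /\ T <= mdist p (b n).
        by apply: filterI; [exact: a_far'|exact: b_far'].
      have [n [fa fb] H] := appr [:: p; q; r p; r q] _ (e / 4) e1 nP.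
      case: (H p); rewrite ?inE ?eqxx ?orbT //.
      case: (H q); rewrite ?inE ?eqxx ?orbT //.
      case: (H (r p)); rewrite ?inE ?eqxx ?orbT //.
      case: (H (r q)); rewrite ?inE ?eqxx ?orbT //.
      have [rca rcb] := HC n.
      have := mdist_ge0 p q; have := metric_triangle p q (b n).
      have := sh (a n) p q rca; have := sh (b n) q p rcb.
      by rewrite /xs (metric_sym q p); move: fa fb; rewrite /T; have := delta0; lra.
    apply/ler_addgt0Pr => e e0; have e1 : 0 < e / 2 by lra.
    pose T := C0 + mdist o p + C + 2 * delta + 1.
    have nP : \forall n \near \oo, T <= mdist p (a n) /\ T <= mdist p (b n).
      by apply: filterI; [exact: a_far'|exact: b_far'].
    have [n [fa fb] H] := appr [:: p; r p] _ (e / 2) e1 nP.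
    case: (H p); rewrite ?inE ?eqxx ?orbT //.
    case: (H (r p)); rewrite ?inE ?eqxx ?orbT //.
    have [rca rcb] := HC n.
    (* Seen from [r p], [r (a n)] and [r (b n)] have the same product as [a n] and [b n] seen from
       [p]. Replacing each of them by its preimage costs [delta], as it is far away and close to
       that preimage. *)
    have := gp_min H4 (r p) (r (a n)) (a n) (r (b n)).
    have := gp_min H4 (r p) (a n) (b n) (r (b n)).
    have := ab_gp n; have := metric_triangle (a n) o p; have := metric_triangle (b n) o p.
    have := metric_triangle (r (a n)) (a n) (r p).
    have := metric_triangle (r (b n)) (b n) (r p).
    move: fa fb (metric_sym (b n) (r (b n))) (metric_sym p (a n)) (metric_sym p (b n)).
    by rewrite /ys /T /gromov_product !iso; have := delta0; lra.
  move=> r r' rK r'K iso rC p q.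
  have iso' u v : mdist (r' u) (r' v) = mdist u v by rewrite -iso !r'K.
  have rC' : exists C, forall n, mdist (r' (a n)) (a n) <= C /\ mdist (r' (b n)) (b n) <= C.
    have [C HC] := rC; exists C => n; have [? ?] := HC n.
    rewrite -(iso (r' (a n))) -(iso (r' (b n))) !r'K.
    by rewrite (metric_sym (a n)) (metric_sym (b n)).
  have [? ?] := shift1 r iso rC p q; have [? _] := shift1 r iso rC q p.
  have [_ +] := shift1 r' iso' rC' (r p) p; rewrite rK => ?.
  by rewrite !ler_norml; split; lra.
Unshelve. all: by end_near.
Qed.

End Line.

(** * The axis of a hyperbolic element *)

Lemma gexpz_sub (G : groupType) (g : G) (i n : nat) :
  gexpz g (i%:Z - n%:Z) = (g ^- n * g ^+ i)%g.
Proof.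
have [ni|/ltnW ni] := leqP n i.
  rewrite subzn // /gexpz expgnFr //.
  by apply: commuteV; apply: commute_sym; exact: commuteX2 (commute_refl _).
have -> : i%:Z - n%:Z = - (n - i)%N%:Z by rewrite -subzn // opprB.
have -> : gexpz g (- (n - i)%N%:Z) = (g ^- (n - i))%g.
  by case: (n - i)%N => [|k]; rewrite ?oppr0 /= ?expg0 ?invg1 // -NegzE.
by rewrite expgnFr // invgF; apply: commuteV; apply: commuteX2.
Qed.

Section Action.
Context {R : realType} {X : metricType R} {G : groupType} (act : G -> X -> X).
Hypothesis G_act : isometric_action act.

Lemma act1 x : act 1%g x = x. Proof. by case: G_act. Qed.
Lemma actM g h x : act (g * h)%g x = act g (act h x). Proof. by case: G_act. Qed.
Lemma act_iso g x y : mdist (act g x) (act g y) = mdist x y. Proof. by case: G_act. Qed.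
Lemma actK g : cancel (act g) (act g^-1%g).
Proof. by move=> x; rewrite -actM mulVg act1. Qed.
Lemma actVK g : cancel (act g^-1%g) (act g).
Proof. by move=> x; rewrite -actM mulgV act1. Qed.
Lemma act_isoV g x y : mdist (act g^-1%g x) y = mdist x (act g y).
Proof. by rewrite -(act_iso g) actVK. Qed.

Lemma displacement_le g x : displacement act g <= mdist x (act g x).
Proof.
apply: ge_inf; last by exists x.
by exists 0 => _ [y _ <-]; exact: mdist_ge0.
Qed.

Lemma gp_act g x y z :
  gromov_product (act g x) (act g y) (act g z) = gromov_product x y z.
Proof. by rewrite /gromov_product !act_iso. Qed.

Lemma translation_length_cvg g : hyperbolic_elt act g -> forall x,
  (fun n : nat => mdist x (act (g ^+ n)%g x) / n%:R) @ \oo --> translation_length act g.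
Proof.
rewrite /hyperbolic_elt /translation_length; case: xgetP => [l -> //|_].
by rewrite -[X in 0 < X]/(0 : R) ltxx.
Qed.

End Action.

(** Commuting with one positive power already bounds the displacement of all points [h ^ n o], and
    it is what a coincidence found by the pigeonhole principle provides. *)
Definition commutes_with_power (G : groupType) (h r : G) :=
  exists2 k, (0 < k)%N & (r * h ^+ k = h ^+ k * r)%g.

(** WPD only tests points of [gam], whence [axis_dense]. The error in [axis_shift] is independent of
    [n], even if [lam] is far below [delta]. *)
Record axis_coordinates (R : realType) (X : metricType R) (G : groupType)
    (act : G -> X -> X) (delta lam : R) (h : G) (gam : set X) (x y : X -> R) : Prop :=
  AxisCoordinates {
  axis_line : line_coordinates delta x y;
  axis_shift : forall n p, `|x (act (h ^+ n)%g p) - x p - n%:R * lam| <= 2 * delta;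
  axis_comm : forall r, commutes_with_power h r -> forall p q,
    `|(x (act r p) - x p) - (x (act r q) - x q)| <= 2 * delta /\
    `|y (act r p) - y p| <= 2 * delta;
  axis_dense : forall v, exists m, [/\ gam m, `|x m - v| <= 6 * delta & y m <= 7 * delta] }.

Lemma finite_upper_bound (R : realType) (f : nat -> R) k :
  exists C, forall s, (s < k)%N -> f s <= C.
Proof.
elim: k => [|k [C HC]]; first by exists 0.
exists (Num.max C (f k)) => s; rewrite ltnS leq_eqVlt => /orP[/eqP ->|/HC sC].
  by rewrite le_max lexx orbT.
by rewrite le_max sC.
Qed.

Section Axis.
Context {R : realType} {X : metricType R} {G : groupType} (act : G -> X -> X).
Context (delta : R) (h : G) (gam : set X).
Hypothesis delta0 : 0 < delta.
Hypothesis X_hyp : hyperbolic_space X delta.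
Hypothesis G_act : isometric_action act.
Hypothesis h_hyp : hyperbolic_elt act h.
Hypothesis h_axis : is_axis act delta h gam.

Let H4 := hyperbolic_four_point X_hyp.

Lemma is_axis_power : exists2 n, (0 < n)%N &
  10 * delta <= displacement act (h ^+ n)%g /\ translates_axis act (h ^+ n)%g gam.
Proof.
move: h_axis; rewrite /is_axis; case: ifP => [L10 ax|_ [n [n0 L10 ax]]].
  by exists 1%N => //; rewrite expg1.
by exists n.
Qed.

(* [g] moves the midpoint of a geodesic from [o] to [g o] by at least [|o - g o|], which
   forbids a sharp turn at [g o]. *)
Lemma minimal_turn g o (c : R -> X) : 10 * delta <= displacement act g ->
  mdist o (act g o) = displacement act g -> geodesic o (act g o) c ->
  2 * mdist o (act g o) - 4 * delta <= mdist o (act (g ^+ 2)%g o).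
Proof.
move=> L10 Lo [c0 cL cd]; set L := mdist o (act g o) in cL cd *.
have L0 : 10 * delta <= L by rewrite /L Lo.
have := delta0; move=> d0.
pose m := c (L / 2).
have mo : mdist m o = L / 2.
  rewrite -c0 cd; rewrite ?in_itv /= ?lexx /=; [|lra..].
  by rewrite subr0 ger0_norm; lra.
have mgo : mdist m (act g o) = L / 2.
  rewrite -cL cd; rewrite ?in_itv /= ?lexx /= ?andbT; [|lra..].
  by rewrite ler0_norm; lra.
have Lm : L <= mdist m (act g m) by rewrite /L Lo; exact: displacement_le.
have := gp_min H4 (act g o) m o (act g m).
have := gp_min H4 (act g o) o (act (g ^+ 2)%g o) (act g m).
have := act_iso G_act g o (act g o); have := act_iso G_act g (act g o) m.
have := act_iso G_act g m o; have := metric_sym (act g o) m.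
have := metric_sym (act g (act g o)) (act g o); move: mgo mo Lm L0.
rewrite expg2 (actM G_act) /gromov_product /L; lra.
Qed.

Lemma axis_coordinates_exist :
  exists x y, axis_coordinates act delta (translation_length act h) h gam x y.
Proof.
have [n0 n0_gt0 [L10 [ o [c [Lo geo gamE]]]]] := is_axis_power.
set g := (h ^+ n0)%g in L10 Lo geo gamE.
have d0 := delta0; have M := actM G_act; have iso := act_iso G_act.
pose z k := act (g ^+ k)%g o.
have z0 : z 0%N = o by rewrite /z expg0 (act1 G_act).
have z1 : z 1%N = act g o by rewrite /z expg1.
have zS i j : mdist (z i.+1) (z j.+1) = mdist (z i) (z j) by rewrite /z !expgS !M iso.
have zL : 10 * delta <= mdist (z 0%N) (z 1%N) by rewrite z0 z1 Lo.
have zT : 2 * mdist (z 0%N) (z 1%N) - 4 * delta <= mdist (z 0%N) (z 2%N).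
  by rewrite z0 z1; exact: (minimal_turn L10 Lo geo).
have step := chain_step d0 H4 zS zL zT; have far := chain_far d0 H4 zS zL zT.
have near := chain_near d0 H4 zS zL zT; have add := chain_add d0 H4 zS zL zT.
have shiftB := chain_shiftB zS.
pose a n := act (g ^- n)%g o; pose b n := act (g ^+ n)%g o.
have to_z n p q : mdist (act (g ^- n)%g p) q = mdist p (act (g ^+ n)%g q).
  exact: act_isoV.
have aE n : mdist o (a n) = mdist (z 0%N) (z n) by rewrite metric_sym to_z z0.
have bE n : mdist o (b n) = mdist (z 0%N) (z n) by rewrite z0.
have far_oo (u : nat -> X) : (forall n, mdist o (u n) = mdist (z 0%N) (z n)) ->
    forall K : R, \forall n \near \oo, K <= mdist o (u n).
  move=> uE K; near=> n; rewrite uE; apply: le_trans (far n).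
  rewrite mulrC -ler_pdivrMr; last lra.
  by near: n; exact: nbhs_infty_ger.
have ab_gp n : gromov_product o (a n) (b n) <= 4 * delta.
  rewrite /gromov_product (metric_sym _ o) (metric_sym (b n)) aE bE to_z.
  have -> : act (g ^+ n)%g (b n) = z (n + n)%N by rewrite /z /b expgnDr M.
  by rewrite -z0; have := add n n; lra.
have [x [y [line near_y inc shift]]] :=
  exists_line_coordinates d0 H4 (far_oo a aE) (far_oo b bE) ab_gp.
(* [P N i p] is [g ^ (i - N) p] with natural exponents; a large power of [g] brings all such points
   back to the chain [z]. *)
pose P N i p := act (g ^- N)%g (act (g ^+ i)%g p).
have rebase n N i p : (N <= n)%N -> act (g ^+ n)%g (P N i p) = act (g ^+ (n - N + i))%g p.
  by move=> Nn; rewrite /P -{1}(subnK Nn) expgnDr M (actVK G_act) expgnDr M.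
have y7 N i p : mdist o p + mdist p (act g o) <= mdist o (act g o) -> y (P N i p) <= 7 * delta.
  move=> op; apply: near_y; near=> n.
  have Nn : (N + i < n)%N by near: n; exact: nbhs_infty_gt.
  rewrite -(gp_act G_act (g ^+ n)%g) rebase; last lia.
  rewrite (actVK G_act) -M -expgnDr -[act _ o]/(z _) -z0.
  apply: (near (n - N + i)%N); first lia.
  by rewrite z0 z1 /z expgSr M !iso.
have dPa n N i : (N <= n)%N -> mdist (P N i o) (a n) = mdist (z 0%N) (z (n - N + i)%N).
  by move=> Nn; rewrite -(iso (g ^+ n)%g) rebase // (actVK G_act) metric_sym z0.
have dPb n N i : (N + i <= n)%N ->
    mdist (P N i o) (b n) = mdist (z 0%N) (z (n + n - (n - N + i))%N).
  move=> Nn; rewrite -(iso (g ^+ n)%g) rebase; last lia.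
  by rewrite -M -expgnDr -!/(z _) shiftB //; lia.
have incx N i : mdist o (act g o) - 6 * delta <= x (P N i.+1 o) - x (P N i o).
  apply: inc; near=> n.
  have Nn : (N + i < n)%N by near: n; exact: nbhs_infty_gt.
  rewrite !dPa ?dPb; [|lia..]; rewrite !addnS -z1 -z0; split.
    by have := step (n - N + i)%N; lra.
  have := step (n + n - (n - N + i).+1)%N.
  have -> : ((n + n - (n - N + i).+1).+1 = n + n - (n - N + i))%N by lia.
  lra.
have PP N i j p : P N i (act (g ^+ j)%g p) = P N (i + j)%N p by rewrite /P expgnDr M.
have grow N j : 4 * delta * j%:R <= x (P N j o) - x (P N 0%N o).
  elim: j => [|j IH]; first by rewrite mulr0 subrr.
  by have := incx N j; rewrite -(natr1 j); move: zL; rewrite z0 z1; lra.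
have dense v : exists m, [/\ gam m, `|x m - v| <= 6 * delta & y m <= 7 * delta].
  have fall N : x (P N 0%N o) <= x o - 4 * delta * N%:R.
    have := grow N N.
    by rewrite /P (actK G_act) expg0 (act1 G_act); lra.
  have arch (u : R) : exists n, u <= 4 * delta * n%:R.
    have [n un] : exists n : nat, u / (4 * delta) <= n%:R.
      by have [n _ /(_ n (leqnn n))] := nbhs_infty_ger (u / (4 * delta)); exists n.
    by exists n; rewrite mulrC -ler_pdivrMr //; lra.
  have [N NP] : exists N, x (P N 0%N o) <= v.
    by have [N ?] := arch (x o - v); exists N; have := fall N; lra.
  have [j jP] : exists j, v < x (P N j o).
    have [j ?] := arch (v - x (P N 0%N o) + 1); exists j.
    by have := grow N j; lra.
  have jex : exists j, v < x (P N j o) by exists j.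
  case: (ex_minnP jex) => -[|k] vk kmin; first by move: vk; rewrite ltNge NP.
  have {kmin}vk' : x (P N k o) <= v.
    by rewrite leNgt; apply/negP => /kmin; rewrite ltnn.
  have [c0 cL cd] := geo; set L := mdist o (act g o) in cL cd.
  have lipx := line_lipx line.
  have isoP i p q : mdist (P N i p) (P N i q) = mdist p q by rewrite /P !iso.
  have PkS : P N k.+1 o = P N k (act g o) by rewrite -addn1 -PP expg1.
  (* Along this segment of length [L], [x] is 1-Lipschitz and increases by at least [L - 6 * delta],
     so its point at distance [t] has coordinate within [6 * delta] of [v]. *)
  pose t := v - x (P N k o).
  have t0 : 0 <= t by rewrite subr_ge0.
  have tL : t <= L.
    have := lipx (P N k.+1 o) (P N k o); rewrite PkS isoP (metric_sym _ o) -/L -PkS.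
    by rewrite ler_norml /t; lra.
  have oct : mdist o (c t) = t.
    by rewrite -c0 cd ?in_itv /= ?lexx ?t0 ?tL ?(le_trans t0) // sub0r normrN ger0_norm.
  have ctg : mdist (c t) (act g o) = L - t.
    rewrite -cL cd ?in_itv /= ?lexx ?t0 ?tL ?(le_trans t0) //.
    by rewrite ler0_norm; lra.
  exists (P N k (c t)); split.
  - rewrite gamE; exists (k%:Z - N%:Z) => //; exists t; last by rewrite gexpz_sub M.
    by rewrite /= in_itv /= t0 tL.
  - have := lipx (P N k (c t)) (P N k o); have := lipx (P N k.+1 o) (P N k (c t)).
    rewrite PkS !isoP (metric_sym _ o) oct (metric_sym _ (c t)) ctg -PkS.
    have := incx N k; rewrite -/L !ler_norml /t; lra.
  - by apply: y7; rewrite oct ctg -/L; lra.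
have bounded (r e : G) k : (0 < k)%N -> commute r (e ^+ k)%g ->
    exists C, forall m, mdist (act r (act (e ^+ m)%g o)) (act (e ^+ m)%g o) <= C.
  move=> k0 rek.
  have [C HC] :=
    finite_upper_bound (fun s => mdist (act r (act (e ^+ s)%g o)) (act (e ^+ s)%g o)) k.
  exists C => m; rewrite (divn_eq m k) mulnC expgnDr expgnA M -(M r) (commuteX _ rek) M iso.
  by apply: HC; rewrite ltn_mod.
have comm r : commutes_with_power h r -> forall p q,
    `|(x (act r p) - x p) - (x (act r q) - x q)| <= 2 * delta /\
    `|y (act r p) - y p| <= 2 * delta.
  move=> [k k0 rk] p q; apply: (shift (act r) (act r^-1%g)); [exact: actK|exact: actVK|exact: iso|].
  have [C1 H1] := bounded r h k k0 rk.
  have [C2 H2] : exists C, forall m, mdist (act r (act (h^-1 ^+ m)%g o)) (act (h^-1 ^+ m)%g o) <= C.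
    by apply: (bounded _ _ k) => //; rewrite expVgn; exact: commuteV.
  exists (Num.max C1 C2) => n; rewrite /a /b /g -expgnA -expVgn !le_max H1 H2 orbT.
  by [].
exists x, y; split => //.
(* Averaging: [W] blocks [h ^ n] shift [x] by [W] times the shift of one block, up to [2 * delta]
   per block, and their total shift is close to [n * W * lam]. Dividing by [W] leaves [2 * delta]
   and a term tending to 0. *)
move=> n p; pose phi q n := x (act (h ^+ n)%g q) - x q.
have commh k : commutes_with_power h (h ^+ k)%g.
  by exists 1%N => //; rewrite expg1 -expgSr -expgS.
have quasi k j q : `|phi o (k * j)%N - j%:R * phi q k| <= 2 * delta * j%:R.
  elim: j => [|j IH].
    by rewrite muln0 /phi expg0 (act1 G_act) subrr mul0r subr0 normr0 mulr0.
  have [+ _] := comm _ (commh k) (act (h ^+ (k * j))%g o) q.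
  have -> : phi o (k * j.+1)%N = (x (act (h ^+ k)%g (act (h ^+ (k * j))%g o)) -
       x (act (h ^+ (k * j))%g o)) + phi o (k * j)%N.
    by rewrite /phi -M -expgnDr mulnS; lra.
  by move: IH; rewrite -(natr1 j) !ler_norml /phi; lra.
(* [x] increases along the powers of [g]: on multiples of [n0], [phi] is nonnegative
   and so is compared with the displacement without its sign. *)
have phi_ge0 k : 0 <= phi o (n0 * k)%N.
  have := grow 0%N k; rewrite /P /phi expgnA !expg0 invg1 !(act1 G_act).
  by apply: le_trans; rewrite !mulr_ge0 //; lra.
set lam := translation_length act h.
have cv := translation_length_cvg h_hyp o; rewrite -/lam in cv.
case: n => [|n]; first by rewrite expg0 (act1 G_act) subrr mul0r subrr normr0; lra.
apply/ler_addgt0Pr => e e0.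
have e1 : 0 < e / (2 * n.+1%:R) by rewrite divr_gt0 // mulr_gt0.
have y_o := line_ge0 line o; set K := 2 * y o + 4 * delta.
have : \forall N \near \oo, `|lam - mdist o (act (h ^+ N)%g o) / N%:R| < e / (2 * n.+1%:R).
  exact: cvgr_dist_lt.
move=> [N0 _ HN].
have [j0 _ Hj] := nbhs_infty_ger (2 * K / e).
(* A multiple of [n0], for [phi_ge0], large enough for the displacement of [h ^ T] to be close to
   [T * lam] and for [K <= e * W / 2]. *)
pose W := (n0 * (N0 + j0).+1)%N; pose T := (n.+1 * W)%N.
have W0 : 0 < W%:R :> R by rewrite ltr0n muln_gt0 n0_gt0.
have j0W : (j0 <= W)%N.
  by apply: leq_trans (leq_pmull _ n0_gt0); rewrite leqW // leq_addl.
have KW : 2 * K <= e * W%:R by rewrite (mulrC e) -ler_pdivrMr //; exact: (Hj _ j0W).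
have N0T : (N0 <= T)%N.
  apply: leq_trans (leq_pmull _ (ltn0Sn n)); apply: leq_trans (leq_pmull _ n0_gt0).
  by rewrite leqW // leq_addr.
have TE : T%:R = n.+1%:R * W%:R :> R by rewrite natrM.
have n1 : 0 < n.+1%:R :> R by [].
have := HN T N0T; rewrite -(ltr_pM2r (_ : 0 < T%:R)); last by rewrite TE mulr_gt0.
have -> : e / (2 * n.+1%:R) * T%:R = e * W%:R / 2.
  have aux (u w : R) : u != 0 -> e / (2 * u) * (u * w) = e * w / 2 by move=> ?; field.
  by rewrite TE aux // lt0r_neq0.
rewrite -{2}[T%:R]ger0_norm ?ler0n // -normrM mulrBl divfK; last by rewrite TE mulf_neq0 ?gt_eqF.
have := quasi n.+1 W p; have := phi_ge0 (n.+1 * (N0 + j0).+1)%N.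
rewrite mulnCA -/W -/T.
set d := mdist _ _; set f := phi o T.
have fd : `|f| <= d by rewrite /f /d metric_sym; exact: (line_lipx line).
have df : d <= `|f| + K.
  have := line_upper line o (act (h ^+ T)%g o); rewrite distrC -/d.
  have [_] := comm _ (commh T) o o; rewrite ler_norml /K /f /phi; lra.
move=> f0; rewrite (ger0_norm f0) in fd df *.
rewrite -/(phi p n.+1) TE => q1 q2.
rewrite -(ler_pM2l W0) -{1}[W%:R]ger0_norm ?ler0n // -normrM.
by move: q1 q2; rewrite ltr_norml !ler_norml; lra.
Unshelve. all: by end_near.
Qed.

End Axis.

(** * Overlaps of translated axes *)

Lemma nat_floor (R : realType) (u : R) : 0 <= u -> exists n : nat, n%:R <= u < n.+1%:R.
Proof. by move=> u0; exists (Num.truncn u); exact: truncn_itv. Qed.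

Lemma size_le_card_fset_set (T : choiceType) (F : set T) (s : seq T) :
  finite_set F -> uniq s -> {in s, forall g, F g} -> (size s <= #|` fset_set F|)%N.
Proof.
move=> finF us sF; have -> : size s = #|` [fset g in s]%fset|.
  by rewrite card_fseq undup_id.
apply: fsubset_leq_card; apply/fsubsetP => g.
by rewrite !inE => /sF Fg; rewrite in_fset_set // inE.
Qed.

Definition signed (R : pzRingType) (b : bool) (u : R) : R := if b then u else - u.

Section Transfer.
Context {R : realType} {X : metricType R} (delta : R).
Implicit Types (x y : X -> R).

Lemma line_signed b x y : line_coordinates delta x y ->
  line_coordinates delta (fun p => signed b (x p)) y.
Proof.
case: b => // -[? ? ? ? ?]; split => // p q; by rewrite /signed -opprD normrN.
Qed.

(* [s] is the distance from [p], up to a few [delta], at which a geodesic from [p] to [q]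
   passes by [m]; if it also follows the second line there, [m] is close to that line. *)
Lemma transfer x y x' y' p q m Y : 0 < delta ->
  line_coordinates delta x y -> line_coordinates delta x' y' ->
  y m <= Y -> Y <= 15 * delta ->
  let s := y p + (x m - x p) in
  y p + 100 * delta <= s -> s <= y p + (x q - x p) - 100 * delta ->
  y' p + 100 * delta <= s -> s <= y' p + (x' q - x' p) - 100 * delta ->
  y' m <= Y + 6 * delta /\ `|x' m - x' p - (s - y' p)| <= 2 * Y + 12 * delta.
Proof.
move=> d0 L L' ym Y15 s s1 s2 s3 s4.
have Y0 := line_ge0 L m.
have pm : mdist p m <= s + Y + 2 * delta.
  have := line_upper L p m; have [[]|[]] := normr_cases (x p - x m); rewrite /s in s1 *; lra.
have mq : mdist m q <= y p + (x q - x p) + y q - s + Y + 2 * delta.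
  have := line_upper L m q; have [[]|[]] := normr_cases (x m - x q); rewrite /s in s1 s2 *; lra.
have pq : y p + (x q - x p) + y q - 2 * delta <= mdist p q.
  have := line_lower L p q; have [[]|[]] := normr_cases (x p - x q); rewrite /s in s1 s2 *; lra.
have tr := metric_triangle p m q.
have pq' : mdist p q <= x' q - x' p + y' p + y' q + 2 * delta.
  have := line_upper L' p q; have [[]|[]] := normr_cases (x' p - x' q); lra.
have := line_upper L' p m; have := line_upper L' m q.
have := line_lower L' p m; have := line_lower L' m q.
have := line_ge0 L' m; have := line_ge0 L' p; have := line_ge0 L' q.
move=> ? ? ?.
have [[? ->]|[? ->]] := normr_cases (x' m - x' q); last first.
  have [[? ->]|[? ->]] := normr_cases (x' p - x' m).
    by move=> [?|?] [?|?] ? ?; exfalso; lra.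
  move=> [?|?] [?|?] ? ?; [exfalso; lra|exfalso; lra|exfalso; lra|].
  by split; [lra|rewrite ler_norml; lra].
have [[? ->]|[? ->]] := normr_cases (x' p - x' m).
  by move=> [?|?] [?|?] ? ?; exfalso; lra.
by move=> [?|?] [?|?] ? ?; exfalso; lra.
Qed.

End Transfer.

(** * Elements normalizing a power of h up to inversion *)

Section Elementary.
Context {G : groupType} (h : G).
Implicit Types t r : G.

(** The sign is a boolean, so that orientations compose by [==]. *)
Definition hpow (b : bool) (n : nat) : G := ((if b then h else h^-1) ^+ n)%g.

Lemma hpowV b n : ((hpow b n)^-1 = hpow (~~ b) n)%g.
Proof. by rewrite /hpow -expVgn; case: b => //=; rewrite invgK. Qed.

Lemma hpow_comm b b' n m : commute (hpow b n) (hpow b' m).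
Proof.
apply: commuteX2; case: b; case: b' => //=.
- by apply: commuteV.
- by apply: commute_sym; apply: commuteV.
Qed.

(* [b] tells whether [t] preserves the direction of the axis of [h]. *)
Definition elementary t : Prop := exists b k, (0 < k)%N /\ (t * h ^+ k = hpow b k * t)%g.

Lemma conj_hpow t b k c m : (t * h ^+ k = hpow b k * t)%g ->
  (t * hpow c (k * m) = hpow (b == c) (k * m) * t)%g.
Proof.
move=> tk.
have tm : (t * h ^+ (k * m) = hpow b (k * m) * t)%g.
  rewrite /hpow !expgnA -/(hpow b k); elim: m => [|m IH]; first by rewrite !expg0 mulg1 mul1g.
  by rewrite !expgSr mulgA IH -!mulgA tk.
case: c => /=; first by case: b tm {tk}.
have -> : (b == false) = ~~ b by case: b {tk tm}.
rewrite -(hpowV true) -hpowV; apply: (mulIg (h ^+ (k * m))%g).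
by rewrite -[RHS]mulgA tm mulKg -mulgA mulVg mulg1.
Qed.

Lemma elementaryV t : elementary t -> elementary t^-1%g.
Proof.
move=> [b [k [k0 tk]]]; exists b, k; split => //.
have := conj_hpow b 1 tk; rewrite muln1 eqxx => tb.
apply: (mulgI t); rewrite mulVKg mulgA tb -mulgA mulgV mulg1.
by rewrite /hpow.
Qed.

Lemma elementaryM t r : elementary t -> elementary r -> elementary (t * r)%g.
Proof.
move=> [b [k [k0 tk]]] [c [m [m0 rm]]]; exists (b == c), (k * m)%N.
split; first by rewrite muln_gt0 k0.
have := conj_hpow true k rm; have := conj_hpow c m tk.
rewrite mulnC /= eqb_id => e1 e2.
by rewrite -mulgA -/(hpow true _) e2 mulgA e1 mulgA.
Qed.

Lemma elementary_hpow b n : elementary (hpow b n).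
Proof. by exists true, 1%N; split => //; exact: (hpow_comm b true n 1). Qed.

Lemma commutes_hpow b n : commutes_with_power h (hpow b n).
Proof. by exists 1%N => //; exact: (hpow_comm b true n 1). Qed.

(** Two reversals of the axis compose to an element preserving its direction: at most two classes of
    directions occur. *)
Lemma elementary_sign t r : elementary t -> elementary r ->
  ~ commutes_with_power h t -> ~ commutes_with_power h r ->
  commutes_with_power h (t^-1 * r)%g.
Proof.
move=> [b [k [k0 tk]]] [c [m [m0 rm]]] nt nr.
case: b tk => tk; first by case: nt; exists k.
case: c rm => rm; first by case: nr; exists m.
exists (k * m)%N; first by rewrite muln_gt0 k0.
have /= e2 := conj_hpow true k rm; have /= e1 := conj_hpow true m tk.
rewrite mulnC in e2; apply: (mulgI t).
by rewrite -mulgA mulVKg -/(hpow true _) e2 mulgA e1 -!mulgA mulVKg.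
Qed.

Lemma commutes_sqr t : elementary t -> commutes_with_power h (t * t)%g.
Proof.
move=> [b [k [k0 tk]]]; exists k => //.
have := conj_hpow b 1 tk; rewrite muln1 eqxx => tb.
by rewrite -mulgA tk mulgA tb -mulgA.
Qed.

Lemma commutes_powerM t r : commutes_with_power h t -> commutes_with_power h r ->
  commutes_with_power h (t * r)%g.
Proof.
move=> [k k0 tk] [m m0 rm]; exists (k * m)%N; first by rewrite muln_gt0 k0.
have e1 := conj_hpow true m (b := true) tk; have /= e2 := conj_hpow true k (b := true) rm.
rewrite mulnC in e2; rewrite -mulgA -/(hpow true _) e2 mulgA e1 mulgA.
by [].
Qed.

Lemma commutes_powerX t n : commutes_with_power h t -> commutes_with_power h (t ^+ n)%g.
Proof.
move=> ct; elim: n => [|n IH]; last by rewrite expgS; exact: commutes_powerM.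
by exists 1%N; rewrite // expg0 mulg1 mul1g.
Qed.

End Elementary.

Record wpd_axis (R : realType) (X : metricType R) (G : groupType) (act : G -> X -> X)
    (delta lam : R) (D : R -> R) (h : G) (gam : set X) (x y : X -> R) : Prop := WpdAxis {
  wpd_delta : 0 < delta;
  wpd_lam : 0 < lam;
  wpd_act : isometric_action act;
  wpd_coordinates : axis_coordinates act delta lam h gam x y;
  wpd_few : forall (eps : R) (p q : X), 0 < eps -> gam p -> gam q ->
    D eps * lam <= mdist p q ->
    let F := [set g : G | mdist (act g p) p <= eps /\ mdist (act g q) q <= eps] in
    finite_set F /\ #|` fset_set F|%:R <= D eps }.

Section Overlap.
Context {R : realType} {X : metricType R} {G : groupType} {act : G -> X -> X}.
Context {delta lam : R} {D : R -> R} {h : G} {gam : set X} {x y : X -> R}.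
Hypothesis W : wpd_axis act delta lam D h gam x y.

Let delta0 := wpd_delta W.
Let lam0 := wpd_lam W.
Let G_act := wpd_act W.
Let ax := wpd_coordinates W.
Let few := wpd_few W.
Let line := axis_line ax.

Local Notation xc t p := (x (act t^-1%g p)).
Local Notation yc t p := (y (act t^-1%g p)).

(** These are the coordinates along the translate of the axis by [t], on which [t * h * t^-1] acts
    as [h] does on the axis. *)
Lemma linec t : line_coordinates delta (fun p => xc t p) (fun p => yc t p).
Proof.
have iso p q : mdist (act t^-1%g p) (act t^-1%g q) = mdist p q by rewrite (act_iso G_act).
case: line => l1 l2 l3 l4 l5; split => [p q|p q|p q|p q|p] //; rewrite -?(iso p q) //.
all: by [exact: l1|exact: l2|exact: l3|exact: l4|exact: l5].
Qed.

Lemma x_hpow b n p : `|x (act (hpow h b n) p) - x p - signed b (n%:R * lam)| <= 2 * delta.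
Proof.
case: b; first exact: (axis_shift ax).
have := axis_shift ax n (act (hpow h false n) p).
rewrite -(hpowV h true) (actVK G_act) /signed !ler_norml; lra.
Qed.

Lemma y_hpow b n p : `|y (act (hpow h b n) p) - y p| <= 2 * delta.
Proof. by have [] := axis_comm ax (commutes_hpow h b n) p p. Qed.

Lemma xc_conj t b n p :
  `|xc t (act (t * hpow h b n * t^-1)%g p) - xc t p - signed b (n%:R * lam)| <= 2 * delta.
Proof. by rewrite !(actM G_act) (actK G_act); exact: x_hpow. Qed.

Lemma yc_conj t b n p :
  `|yc t (act (t * hpow h b n * t^-1)%g p) - yc t p| <= 2 * delta.
Proof. by rewrite !(actM G_act) (actK G_act); exact: y_hpow. Qed.

Lemma far_points (K : R) : exists p q, [/\ gam p, gam q, y p <= 7 * delta, y q <= 7 * delta &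
  K <= mdist p q].
Proof.
have [p [gp + yp]] := axis_dense ax 0; have [q [gq + yq]] := axis_dense ax (K + 12 * delta).
rewrite !ler_norml => ? ?; exists p, q; split => //.
have := line_lipx line p q; rewrite ler_norml; lra.
Qed.

Local Notation D200 := (D (200 * delta)).
Local Notation Lam := (D200 * lam).

Lemma few_size p q (s : seq G) : gam p -> gam q -> Lam <= mdist p q -> uniq s ->
  {in s, forall g, mdist (act g p) p <= 200 * delta /\ mdist (act g q) q <= 200 * delta} ->
  (size s)%:R <= D200.
Proof.
move=> gp gq pq us sF; have d0 := delta0.
have e0 : 0 < 200 * delta by lra.
have [finF cF] := few e0 gp gq pq; apply: le_trans cF.
by rewrite ler_nat; apply: size_le_card_fset_set.
Qed.

Lemma pigeonhole p q (f : nat -> G) (u : R) : gam p -> gam q -> Lam <= mdist p q ->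
  D200 <= u ->
  (forall i, i%:R <= u ->
    mdist (act (f i) p) p <= 200 * delta /\ mdist (act (f i) q) q <= 200 * delta) ->
  exists i j, (i < j)%N /\ f i = f j.
Proof.
move=> gp gq pq Du Hf.
have D0 : 0 <= D200 by have := @few_size p q [::] gp gq pq isT; apply.
have [n /andP[nu un]] := nat_floor (le_trans D0 Du).
pose s := [seq f i | i <- iota 0 n.+1].
have [us|] := boolP (uniq s).
  have := few_size gp gq pq us; rewrite size_map size_iota => /(_ _).
  have H : {in s, forall g, mdist (act g p) p <= 200 * delta /\ mdist (act g q) q <= 200 * delta}.
    move=> g /mapP[i]; rewrite mem_iota add0n ltnS => /= iN ->; apply: Hf.
    by apply: le_trans nu; rewrite ler_nat.
  by move=> /(_ H) nD; lra.
move=> /(uniqPn 1%g)[i [j [ij]]]; rewrite size_map size_iota => jn.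
rewrite !(nth_map 0%N) ?size_iota ?nth_iota ?(ltn_trans ij) // !add0n => fij.
by exists i, j.
Qed.

(* Otherwise too many powers of [h] would move points of the axis by at most [200 * delta]. *)
Lemma Lam_ge : 180 * delta <= Lam.
Proof.
have d0 := delta0; have l0 := lam0.
rewrite leNgt; apply/negP => Lam_lt.
have [p [q [gp gq yp yq pq]]] := far_points Lam.
(* The displacement is at most [i * lam + 20 * delta]: shift error [2], heights [7] and [9], and [2]
   from [line_upper]. *)
have move_le i m : y m <= 7 * delta -> i%:R <= 180 * delta / lam ->
    mdist (act (hpow h true i) m) m <= 200 * delta.
  move=> ym; rewrite ler_pdivlMr // => il.
  have := line_upper line (act (hpow h true i) m) m.
  have := x_hpow true i m; have := y_hpow true i m.
  have l1 : 0 <= i%:R * lam by rewrite mulr_ge0 // ltW.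
  rewrite /signed !ler_norml.
  by have [[_ ->]|[_ ->]] := normr_cases (x (act (hpow h true i) m) - x m); lra.
have [i [j [ij hij]]] : exists i j, (i < j)%N /\ hpow h true i = hpow h true j.
  apply: (pigeonhole gp gq pq (u := 180 * delta / lam)); last by move=> i iu; split; exact: move_le.
  by rewrite ler_pdivlMr // ltW.
have hk : (hpow h true (j - i) = 1)%g.
  apply: (mulgI (hpow h true i)); rewrite mulg1 [in RHS]hij /hpow -expgnDr subnKC //.
  exact: ltnW.
have [n /andP[_ un]] : exists n : nat, n%:R <= 3 * delta / lam < n.+1%:R.
  by apply: nat_floor; apply: divr_ge0; lra.
have := x_hpow true ((j - i) * n.+1) p; rewrite {1}/hpow expgnA -/(hpow h true (j - i)).
rewrite hk expg1n (act1 G_act) subrr sub0r normrN /signed ger0_norm; last first.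
  by rewrite mulr_ge0 // ltW.
move: un; rewrite ltr_pdivrMr // => un.
have : n.+1%:R * lam <= ((j - i) * n.+1)%:R * lam.
  by rewrite ler_pM2r // ler_nat leq_pmull // subn_gt0.
lra.
Qed.

(* On a long overlap [h ^ i] and its conjugate by [t] translate by the same amount, so that
   the elements [h ^ i * (t * h ^ (-+ i) * t^-1)] hardly move two distant points of the axis:
   by WPD two of them coincide. *)
Lemma overlap_increasing t (b c : bool) p q lo hi :
  let X1 := fun p => signed b (x p) in let X2 := fun p => signed c (xc t p) in
  y p <= lo -> yc t p <= lo -> hi <= y p + (X1 q - X1 p) -> hi <= yc t p + (X2 q - X2 p) ->
  lo + 5 * Lam <= hi -> elementary h t.
Proof.
move=> X1 X2 lo1 lo2 hi1 hi2 lohi.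
have d0 := delta0; have l0 := lam0; have L180 := Lam_ge.
have L1 : line_coordinates delta X1 y by exact: line_signed.
have L2 : line_coordinates delta X2 (fun p => yc t p) by apply: line_signed; exact: linec.
have dense v : exists m, [/\ gam m, `|X1 m - v| <= 6 * delta & y m <= 7 * delta].
  have [m [gm xm ym]] := axis_dense ax (signed b v); exists m; split => //.
  by move: xm; rewrite /X1 /signed !ler_norml; case: (b); lra.
pose f i := (hpow h true i * (t * hpow h (b != c) i * t^-1))%g.
have fE i : i%:R * lam <= Lam -> forall m, y m <= 7 * delta ->
    lo + Lam + 140 * delta <= y p + (X1 m - X1 p) <= hi - Lam - 140 * delta ->
    mdist (act (f i) m) m <= 200 * delta.
  move=> iL m ym /andP[s1 s2].
  have il0 : 0 <= i%:R * lam by rewrite mulr_ge0 // ltW.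
  (* [m] goes to the second line with [Y = 7 * delta], is moved there by at most [Lam], and returns
     with [Y = 15 * delta], the largest value that [transfer] allows. *)
  have [|||||y2 x2] := transfer d0 L1 L2 (p := p) (q := q) ym; [lra..|].
  pose m' := act (t * hpow h (b != c) i * t^-1)%g m.
  have x2' : `|X2 m' - X2 m + signed b (i%:R * lam)| <= 2 * delta.
    have := xc_conj t (b != c) i m; rewrite -/m' /X2 /signed !ler_norml.
    by case: (b) (c) => -[] /=; lra.
  have y2' := yc_conj t (b != c) i m; rewrite -/m' in y2'.
  have ym' : yc t m' <= 15 * delta by move: y2'; rewrite ler_norml; lra.
  have sb : signed b (i%:R * lam) <= Lam /\ - Lam <= signed b (i%:R * lam).
    by rewrite /signed; case: (b); lra.
  move: x2 x2'; rewrite !ler_norml => x2 x2'.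
  have [|||||y1 x1] := transfer d0 L2 L1 (p := p) (q := q) ym'; [lra..|].
  have x3 := x_hpow true i m'; have y3 := y_hpow true i m'.
  have up := line_upper line (act (hpow h true i) m') m.
  rewrite /f (actM G_act) -/m'.
  move: x1 x3 y3 up; rewrite !ler_norml /X1 /signed in x2 x2' *.
  set a := act (hpow h true i) m'.
  by have [[_ ->]|[_ ->]] := normr_cases (x a - x m); case: (b) x2 x2' => /=; lra.
(* The gap [Lam + 20 * delta] absorbs twice the error [6 * delta]. Both points lie in the window of
   [fE] because the overlap is [5 * Lam] and [316 * delta <= 2 * Lam]. *)
have [m1 [g1 v1 y1]] := dense (X1 p + (lo + Lam + 150 * delta) - y p).
have [m2 [g2 v2 y2]] := dense (X1 p + (lo + 2 * Lam + 170 * delta) - y p).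
move: v1 v2; rewrite !ler_norml => v1 v2.
have m12 : Lam <= mdist m1 m2.
  have := line_lipx L1 m1 m2; rewrite ler_norml; lra.
have [i [j [ij fij]]] : exists i j, (i < j)%N /\ f i = f j.
  apply: (pigeonhole g1 g2 m12 (lexx _)) => i iD.
  have iL : i%:R * lam <= Lam by rewrite ler_pM2r.
  by split; apply: fE => //; apply/andP; split; lra.
have hij (e : bool) : hpow h e j = (hpow h e i * hpow h e (j - i))%g.
  by rewrite /hpow -expgnDr subnKC // ltnW.
exists (b == c), (j - i)%N; split; first by rewrite subn_gt0.
move: fij; rewrite /f !hij; set e := b != c; set k := (j - i)%N => fij.
have {}fij : (hpow h true k * t * hpow h e k = t)%g.
  apply: (mulIg (hpow h e i)); apply: (mulIg t^-1%g); apply: (mulgI (hpow h true i)).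
  by rewrite fij (hpow_comm h e e i k : _ * _ = _ * _)%g !mulgA.
rewrite -/(hpow h true k); move: fij; rewrite /e; case: (b == c) => /= fij.
  by rewrite -{1}fij -(hpowV h true) mulgVK.
by rewrite -{2}fij -(hpowV h true) -mulgA mulKg.
Qed.

(** A geodesic from [p] to [q] follows the line of [t] between the distances [yc t p] and
    [yc t p + |xc t q - xc t p|] from [p]. Signs make both coordinates increase from [p] to [q], and
    [t^-1] moves the first line to the axis. *)
Lemma overlap t t' p q lo hi : ~ elementary h (t^-1 * t')%g ->
  yc t p <= lo -> yc t' p <= lo -> hi <= yc t p + `|xc t q - xc t p| ->
  hi <= yc t' p + `|xc t' q - xc t' p| -> hi < lo + 5 * Lam.
Proof.
move=> nE; rewrite ltNge => lo1 lo2 hi1 hi2; apply/negP => lohi; apply: nE.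
have abs (u v : R) : exists b, `|u - v| = signed b u - signed b v.
  by have [[_ ->]|[_ ->]] := normr_cases (u - v); [exists true|exists false]; rewrite /signed; lra.
have [b bE] := abs (xc t q) (xc t p); have [c cE] := abs (xc t' q) (xc t' p).
rewrite bE in hi1; rewrite cE in hi2.
apply: (@overlap_increasing _ b c (act t^-1%g p) (act t^-1%g q) lo hi) => //;
  by rewrite -?(actM G_act) invgM invgK -mulgA mulgV mulg1.
Qed.

End Overlap.

Section Counting.
Context {R : realType} {X : metricType R} {G : groupType} {act : G -> X -> X}.
Context {delta lam : R} {D : R -> R} {h : G} {gam : set X} {x y : X -> R}.
Hypothesis W : wpd_axis act delta lam D h gam x y.

Let delta0 := wpd_delta W.
Let lam0 := wpd_lam W.
Let G_act := wpd_act W.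
Let ax := wpd_coordinates W.
Let line := axis_line ax.

Local Notation xc t p := (x (act t^-1%g p)).
Local Notation yc t p := (y (act t^-1%g p)).
Local Notation D200 := (D (200 * delta)).
Local Notation Lam := (D200 * lam).

Lemma commutes_quasi r p n : commutes_with_power h r ->
  `|x (act (r ^+ n)%g p) - x p - n%:R * (x (act r p) - x p)| <= n%:R * (2 * delta).
Proof.
move=> cr; elim: n => [|n IH].
  by rewrite expg0 (act1 G_act) subrr !mul0r subr0 normr0.
have [+ _] := axis_comm ax cr (act (r ^+ n)%g p) p.
by rewrite expgS (actM G_act) -(natr1 n); move: IH; rewrite !ler_norml; lra.
Qed.

(* If [r] also preserves the line of [c], it cannot translate: iterating it
   would make the two lines overlap indefinitely. *)
Lemma elementary_conj_shift c r p : ~ elementary h c -> commutes_with_power h r ->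
  elementary h (c^-1 * r * c)%g -> `|x (act r p) - x p| <= 2 * delta.
Proof.
move=> nc cr ec; rewrite leNgt; apply/negP => big.
have d0 := delta0; have L180 := Lam_ge W.
set u := `|x (act r p) - x p| - 2 * delta.
have u0 : 0 < u by rewrite /u; lra.
set K := y p + 3 * yc c p + 6 * Lam + 30 * delta.
have yp := line_ge0 line p; have ycp := line_ge0 line (act c^-1%g p).
have [n /andP[_ Kn]] : exists n : nat, n%:R <= K / u < n.+1%:R.
  by apply: nat_floor; apply: divr_ge0; rewrite /K; lra.
set k := n.+1 in Kn.
(* An even power, since [c^-1 * r * c] may reverse the axis whereas its square does not. *)
have := commutes_quasi p (k + k) cr; rewrite natrD.
set e := (r ^+ (k + k))%g => qe.
have Ku : K < `|x (act e p) - x p|.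
  rewrite ltr_pdivrMr // in Kn.
  have k0 : 0 < k%:R :> R by rewrite ltr0n.
  have : k%:R * u <= `|x (act e p) - x p|.
    move: qe; rewrite ler_norml /u => qe.
    have := ler_norm (x (act e p) - x p); have := ler_norm (- (x (act e p) - x p)).
    have kd : 0 <= k%:R * delta by rewrite mulr_ge0 // ltW.
    have ku : 0 <= k%:R * (`|x (act r p) - x p| - 2 * delta) by rewrite mulr_ge0 // ltW.
    rewrite normrN.
    have [[? E]|[? E]] := normr_cases (x (act r p) - x p); rewrite E in ku *; lra.
  lra.
have [_ ye] := axis_comm ax (commutes_powerX (k + k) cr) p p.
have ce : (c^-1 * e * c = ((c^-1 * r * c) * (c^-1 * r * c)) ^+ k)%g.
  have conjX m : ((c^-1 * r * c) ^+ m = c^-1 * r ^+ m * c)%g.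
    elim: m => [|m IH]; first by rewrite !expg0 mulg1 mulVg.
    by rewrite !expgS IH !mulgA mulgK.
  by rewrite -expg2 -expgnA conjX mul2n -addnn.
have cc : commutes_with_power h (c^-1 * e * c)%g.
  by rewrite ce; apply: commutes_powerX; exact: commutes_sqr.
have [_ yce] := axis_comm ax cc (act c^-1%g p) p.
rewrite -(actM G_act) mulgK (actM G_act) in yce.
have up := line_upper (linec W c) p (act e p).
have lo : `|x p - x (act e p)| <= mdist p (act e p) by apply: (line_lipx line).
have := overlap W (t := 1%g) (t' := c) (p := p) (q := act e p)
  (lo := y p + yc c p) (hi := y p + yc c p + 5 * Lam).
rewrite invg1 mul1g !(act1 G_act) => /(_ nc).
rewrite ler_norml in ye; rewrite ler_norml in yce.
move: Ku; rewrite /K => Ku.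
have := distrC (xc c p) (xc c (act e p)); have := distrC (x p) (x (act e p)) => E1 E2.
have H1 : y p <= y p + yc c p by lra.
have H2 : yc c p <= y p + yc c p by lra.
have H3 : y p + yc c p + 5 * Lam <= y p + `|x (act e p) - x p| by lra.
have H4 : y p + yc c p + 5 * Lam <= yc c p + `|xc c (act e p) - xc c p| by lra.
by move=> /(_ H1 H2 H3 H4); rewrite ltxx.
Qed.

(** By [elementary_conj_shift] such elements move points of height at most [7 * delta] by at most
    [20 * delta], so WPD for one distant pair counts them. *)
Lemma count_commuting c (s : seq G) : ~ elementary h c -> uniq s ->
  {in s, forall r, commutes_with_power h r /\ elementary h (c^-1 * r * c)%g} ->
  (size s)%:R <= D200.
Proof.
move=> nc us sE; have [p [q [gp gq yp yq pq]]] := far_points W Lam.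
apply: (few_size W gp gq pq us) => r /sE[cr er].
suff H m : y m <= 7 * delta -> mdist (act r m) m <= 200 * delta by split; exact: H.
move=> ym; have := line_upper line (act r m) m; have := elementary_conj_shift m nc cr er.
have [_] := axis_comm ax cr m m; rewrite ler_norml; have := delta0; lra.
Qed.

(** Bounds the intersection of [E] with its conjugate by [c]. The factor 2 is for reversals, which
    dividing by one of them carries to the case of [count_commuting]. *)
Lemma count_elementary c (s : seq G) : ~ elementary h c -> uniq s ->
  {in s, forall r, elementary h r /\ elementary h (c^-1 * r * c)%g} ->
  (size s)%:R <= 2 * D200.
Proof.
move=> nc us sE.
pose P r := `[< commutes_with_power h r >].
have := count_predC P s; rewrite -!size_filter => <-; rewrite natrD mulr_natl mulr2n lerD //.
  apply: (count_commuting nc); first exact: filter_uniq.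
  by move=> r; rewrite mem_filter => /andP[/asboolP ? /sE[_ ?]].
case E : [seq r <- s | predC P r] => [|r0 s0].
  by have := @count_commuting c [::] nc isT; apply.
have r0P : r0 \in [seq r <- s | predC P r] by rewrite E inE eqxx.
move: (r0P); rewrite mem_filter => /andP[/asboolPn nr0 /sE[er0 cr0]].
rewrite -E -(size_map (fun r => r0^-1 * r)%g).
apply: (count_commuting nc); first by rewrite map_inj_uniq ?filter_uniq //; exact: mulgI.
move=> _ /mapP[r + ->]; rewrite mem_filter => /andP[/asboolPn nr /sE[er cr]].
split; first exact: elementary_sign.
have -> : (c^-1 * (r0^-1 * r) * c = (c^-1 * r0 * c)^-1 * (c^-1 * r * c))%g.
  by rewrite !invgM invgK !mulgA mulgK.
by apply: elementaryM => //; exact: elementaryV.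
Qed.

End Counting.

(** * Proper elementary subgroups *)

Lemma cyclic_subgroupE (G : groupType) (h : G) :
  cyclic_subgroup h = [set g | exists n i, g = (h ^- n * h ^+ i)%g].
Proof.
apply/seteqP; split => [_ [[i|n] _ <-]|g [n [i ->]]].
- by exists 0%N, i; rewrite expg0 invg1 mul1g.
- by exists n.+1, 0%N; rewrite expg0 mulg1.
- by exists (i%:Z - n%:Z) => //; rewrite gexpz_sub.
Qed.

Lemma cyclic_subgroup_hpow (G : groupType) (h : G) b n k : cyclic_subgroup h k ->
  cyclic_subgroup h (hpow h b n * k)%g.
Proof.
rewrite cyclic_subgroupE => -[m [i ->]]; case: b.
  exists m, (n + i)%N; rewrite expgnDr !mulgA; congr (_ * _)%g.
  by apply: commuteV; exact: commuteX2.
exists (n + m)%N, i; rewrite -(hpowV h true) mulgA -invgM -expgnDr addnC.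
by rewrite /hpow.
Qed.

Lemma hpow_coset (G : groupType) (h g : G) b n :
  [set (g * hpow h b n * k)%g | k in cyclic_subgroup h] = [set (g * k)%g | k in cyclic_subgroup h].
Proof.
apply/seteqP; split => _ [k ck <-].
  by exists (hpow h b n * k)%g; [exact: cyclic_subgroup_hpow|rewrite mulgA].
exists (hpow h (~~ b) n * k)%g; first exact: cyclic_subgroup_hpow.
by rewrite -hpowV !mulgA mulgK.
Qed.

Section VirtuallyCyclic.
Context {R : realType} {X : metricType R} {G : groupType} {act : G -> X -> X}.
Context {delta lam : R} {D : R -> R} {h : G} {gam : set X} {x y : X -> R}.
Hypothesis W : wpd_axis act delta lam D h gam x y.

Let G_act := wpd_act W.
Let ax := wpd_coordinates W.
Let line := axis_line ax.

(** A suitable power of [h] brings an element preserving direction to a shift of at most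
    [lam + 2 * delta] at [p], hence to displacement at most [eps] at two distant points: WPD leaves
    finitely many cosets. Reversals form one more translate of these. *)
Lemma elementary_virtually_cyclic : (forall t, elementary h t) -> virtually_cyclic G.
Proof.
move=> allE; have d0 := wpd_delta W; have l0 := wpd_lam W.
pose eps := lam + 22 * delta.
have e0 : 0 < eps by rewrite /eps; lra.
have [p [q [gp gq yp yq pq]]] := far_points W (D eps * lam).
have [finF _] := wpd_few W e0 gp gq pq.
set F := (X in finite_set X) in finF.
have rep t : commutes_with_power h t -> exists b n, F (hpow h b n * t)%g.
  move=> ct.
  have [b [n bn]] : exists b n, `|x (act (hpow h b n * t)%g p) - x p| <= lam + 2 * delta.
    have ab (u : R) : exists b, u = - signed b `|u|.
      by have [[_ ->]|[_ ->]] := normr_cases u; [exists false|exists true]; rewrite /signed; lra.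
    have [b bE] := ab (x (act t p) - x p).
    have [n /andP[n1 n2]] := nat_floor (divr_ge0 (normr_ge0 (x (act t p) - x p)) (ltW l0)).
    rewrite ler_pdivlMr // in n1; rewrite ltr_pdivrMr // -(natr1 n) mulrDl in n2.
    exists b, n; rewrite (actM G_act); move: (x_hpow W b n (act t p)) bE.
    by rewrite /signed !ler_norml; case: (b); lra.
  exists b, n.
  have cb : commutes_with_power h (hpow h b n * t)%g.
    by apply: commutes_powerM => //; exact: commutes_hpow.
  have mv m : y m <= 7 * delta -> mdist (act (hpow h b n * t)%g m) m <= eps.
    move=> ym; have [+ ye] := axis_comm ax cb m p; rewrite ler_norml => xe.
    rewrite !ler_norml in bn ye; have := line_upper line (act (hpow h b n * t)%g m) m.
    set e := act _ m in xe ye *; rewrite /eps.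
    by have [[_ ->]|[_ ->]] := normr_cases (x e - x m); lra.
  by split; exact: mv.
have cosetF t : commutes_with_power h t -> exists2 f, F f &
      forall g : G, [set (g * t * k)%g | k in cyclic_subgroup h] =
                    [set (g * f^-1 * k)%g | k in cyclic_subgroup h].
  move=> ct; have [|b [n Fbn]] := rep t^-1%g.
    by have [k k0 tk] := ct; exists k => //; exact: commute_sym (commuteV (commute_sym tk)).
  exists (hpow h b n * t^-1)%g => // g.
  by rewrite invgM invgK hpowV mulgA hpow_coset.
pose coset (g : G) := [set (g * k)%g | k in cyclic_subgroup h].
exists h; rewrite /finite_index.
have [[r0 nr0]|allC] := pselect (exists r0, ~ commutes_with_power h r0).
  apply: (@sub_finite_set _ _
    ([set coset (f^-1)%g | f in F] `|` [set coset (r0 * f^-1)%g | f in F])).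
    move=> _ [t _ <-]; have [ct|nt] := pselect (commutes_with_power h t).
      left; have [f Ff fE] := cosetF t ct; exists f => //.
      by have := fE 1%g; rewrite !mul1g => ->.
    right; have [f Ff fE] := cosetF _ (elementary_sign (allE r0) (allE t) nr0 nt).
    by exists f => //; rewrite /coset -fE mulVKg.
  by rewrite finite_setU; split; exact: finite_image.
apply: (@sub_finite_set _ _ [set coset (f^-1)%g | f in F]); last exact: finite_image.
move=> _ [t _ <-]; have [|f Ff fE] := cosetF t.
  by apply: contrapT => nt; apply: allC; exists t.
by exists f => //; have := fE 1%g; rewrite !mul1g => ->.
Qed.

End VirtuallyCyclic.

(** * Free semigroups *)

Section FreeWords.
Context {R : realType} {X : metricType R} {G : groupType} (act : G -> X -> X).
Context (delta : R) (o : X) (T : eqType) (ev : T -> G) (r r' : T -> R) (adm : rel T).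
Hypothesis delta0 : 0 < delta.
Hypothesis H4 : @four_point R X delta.
Hypothesis G_act : isometric_action act.
Implicit Types (a b : T) (s t c : seq T).

Definition evw s : G := (\prod_(a <- s) ev a)%g.
Local Notation gpo g k := (gromov_product o (act g o) (act k o)).

(* [r a] and [r' a] bound how long the path to [ev a o] and the reverse path
   can fellow travel with the neighbouring letters of an admissible word. *)
Variable letters : seq T.
Hypothesis length_ge : {in letters, forall a, 0 <= r' a /\
  r a + r' a + 4 * delta <= mdist (act (ev a) o) o}.
Hypothesis turn_le : {in letters &, forall a b, adm a b ->
  gpo (ev a)^-1%g (ev b) <= r' a /\ gpo (ev a)^-1%g (ev b) <= r b}.

Lemma word_start a s : {subset a :: s <= letters} -> path adm a s ->
  r a + 3 * delta <= gpo (evw (a :: s)) (ev a).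
Proof.
have d0 := delta0.
elim: s a => [|b s IH] a sub.
  have [? ?] := length_ge (sub a (mem_head _ _)).
  by rewrite /evw big_seq1 gp_xx; lra.
move=> /= /andP[ab bs].
have La : a \in letters by apply: sub; rewrite mem_head.
have Lb : b \in letters by apply: sub; rewrite !inE eqxx orbT.
have [? ?] := length_ge La; have [t1 t2] := turn_le La Lb ab.
have := IH b _ bs; move=> /(_ (fun z zs => sub z (mem_behead (s := a :: b :: s) zs))) IHb.
have := gp_min H4 o (act (ev a)^-1%g o) (act (evw (b :: s)) o) (act (ev b) o).
have -> : evw (a :: b :: s) = (ev a * evw (b :: s))%g by rewrite /evw big_cons.
have E : gromov_product (act (ev a) o) o (act (ev a * evw (b :: s))%g o) =
    gpo (ev a)^-1%g (evw (b :: s)).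
  by rewrite -(gp_act G_act (ev a) o) (actVK G_act) (actM G_act).
by rewrite (gpC o (act (ev a * _)%g o)) (gpK o (act (ev a) o)) E; lra.
Qed.

Lemma word_neq a b s t : {subset a :: s <= letters} -> {subset b :: t <= letters} ->
  path adm a s -> path adm b t ->
  gpo (ev a) (ev b) <= r a -> gpo (ev a) (ev b) <= r b -> evw (a :: s) <> evw (b :: t).
Proof.
move=> sa sb pa pb ga gb E; have := word_start sa pa; have := word_start sb pb; rewrite -E.
have := gp_min H4 o (act (ev a) o) (act (evw (a :: s)) o) (act (ev b) o).
rewrite (gpC _ (act (ev a) o) (act (evw _) o)); have := delta0; lra.
Qed.

(** The fixed tail [c] serves both constructions: empty for single conjugates, one common letter for
    products of two. *)
Lemma free_words (U c : seq T) : {subset U <= letters} -> {subset c <= letters} ->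
  {in U &, forall a b, a != b -> gpo (ev a) (ev b) <= r a /\ gpo (ev a) (ev b) <= r b} ->
  {in U &, forall a b, path adm a (rcons c b)} ->
  forall s t, {subset s <= U} -> {subset t <= U} -> size s = size t ->
    (\prod_(a <- s) evw (a :: c))%g = (\prod_(a <- t) evw (a :: c))%g -> s = t.
Proof.
move=> UL cL Udiv Uadm.
pose flat s := flatten [seq a :: c | a <- s].
have evflat s : (\prod_(a <- s) evw (a :: c))%g = evw (flat s).
  elim: s => [|a s IH]; first by rewrite /evw !big_nil.
  by rewrite big_cons IH -[flat (a :: s)]/((a :: c) ++ flat s) /evw big_cat.
have flatL s : {subset s <= U} -> {subset flat s <= letters}.
  move=> sU z /flattenP[_ /mapP[a /sU aU ->]]; rewrite inE => /orP[/eqP ->|/cL //].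
  exact: UL.
have flat_path a s : a \in U -> {subset s <= U} -> path adm a (c ++ flat s).
  elim: s a => [|b s IH] a aU sU.
    by have := Uadm a a aU aU; rewrite cats0 rcons_path => /andP[].
  have bU : b \in U by apply: sU; rewrite mem_head.
  rewrite -[flat _]/(b :: (c ++ flat s)) -cat_rcons cat_path Uadm // last_rcons.
  by apply: IH => // z zs; apply: sU; rewrite inE zs orbT.
elim=> [|a s IH] [|b t] //= sU tU [st]; rewrite !big_cons.
have aU : a \in U by apply: sU; rewrite mem_head.
have bU : b \in U by apply: tU; rewrite mem_head.
have sU' : {subset s <= U} by move=> z zs; apply: sU; rewrite inE zs orbT.
have tU' : {subset t <= U} by move=> z zs; apply: tU; rewrite inE zs orbT.
have [->|ab] := eqVneq a b; first by move=> /mulgI /IH -> //.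
have [g1 g2] := Udiv a b aU bU ab.
have E z v : (evw (z :: c) * evw (flat v) = evw (z :: (c ++ flat v)))%g.
  by rewrite /evw -big_cat.
have L z v : z \in U -> {subset v <= U} -> {subset z :: (c ++ flat v) <= letters}.
  move=> zU vU w; rewrite inE mem_cat => /orP[/eqP ->|/orP[/cL //|]]; first exact: UL.
  exact: flatL.
rewrite !evflat !E => /word_neq [] //; first [exact: L | exact: flat_path].
Qed.

End FreeWords.

(** * Lines followed in turn by a geodesic *)

Section Separation.
Context {R : realType} {X : metricType R} (delta Lam H : R).
Implicit Types (x y : X -> R).
Hypothesis delta0 : 0 < delta.
Hypothesis LamP : 180 * delta <= Lam.
Hypothesis HP : 1000 * Lam <= H.

Section Increasing.
Variables (x1 y1 x2 y2 : X -> R) (p q b : X).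
Hypothesis L1 : line_coordinates delta x1 y1.
Hypothesis L2 : line_coordinates delta x2 y2.
Hypothesis D1 : H / 4 <= x1 q - x1 p.
Hypothesis D2 : H / 4 <= x2 q - x2 p.
Hypothesis before : y1 p + (x1 q - x1 p) <= y2 p + 6 * Lam.
Hypothesis b_on : y2 b <= 7 * delta.
Hypothesis b_mid : `|x2 b - (x2 p + x2 q) / 2| <= 6 * delta.

(** By [before], the geodesic from [p] to [q] leaves the first line before it has followed the
    second for long. As [H] is large against [Lam], the middle [b] of the second part is well
    beyond, and projects where [q] does. *)
Lemma separation_proj : `|x1 b - x1 q| <= delta.
Proof.
have d0 := delta0; have lp := LamP; have hp := HP; have d1 := D1; have d2 := D2.
have bf := before; have bo := b_on; move: b_mid; rewrite ler_norml => /andP[bm1 bm2].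
have pb : mdist p b <= y2 p + (x2 b - x2 p) + 9 * delta.
  by have := line_upper L2 p b; have [[? ->]|[? ->]] := normr_cases (x2 p - x2 b); lra.
have bq : mdist b q <= y2 q + (x2 q - x2 b) + 9 * delta.
  by have := line_upper L2 b q; have [[? ->]|[? ->]] := normr_cases (x2 b - x2 q); lra.
have pq : y2 p + (x2 q - x2 p) + y2 q - 2 * delta <= mdist p q.
  by have := line_lower L2 p q; have [[? ->]|[? ->]] := normr_cases (x2 p - x2 q); lra.
have pq1 : mdist p q <= y1 p + (x1 q - x1 p) + y1 q + 2 * delta.
  by have := line_upper L1 p q; have [[? ->]|[? ->]] := normr_cases (x1 p - x1 q); lra.
have tr := metric_triangle p b q.
have u1 := line_upper L1 p b; have u2 := line_upper L1 b q.
have := line_ge0 L1 b; have := line_ge0 L1 q; have := line_ge0 L2 q => ? ? ?.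
have [//|l2] := line_lower L1 b q.
exfalso; have [l1|l1] := line_lower L1 p b.
  move: l1; rewrite ler_norml => /andP[la lb].
  have n1 := ler_norm (x1 p - x1 b); have n2 := ler_norm (x1 q - x1 b).
  rewrite distrC in n2.
  have [[_ E]|[_ E]] := normr_cases (x1 p - x1 b); rewrite E in u1 *; lra.
have n2 := ler_norm (x1 q - x1 b); rewrite distrC in n2.
have n3 := ler_norm (x1 b - x1 q).
by have [[_ E]|[_ E]] := normr_cases (x1 p - x1 b); rewrite E in u1 l1; lra.
Qed.

(* [e] is the projection of [b] to the first line. The path from [z] to [b] follows that line
   for a long time and leaves it near [e], on the [p] side of [b]. *)
Lemma separation_side e z : y1 e <= 7 * delta -> `|x1 e - x1 q| <= 6 * delta ->
  H / 2 <= `|x1 z - x1 b| -> x2 z - x2 b <= - (H / 16).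
Proof.
move=> ye; rewrite ler_norml => /andP[xe1 xe2] xz.
have d0 := delta0; have lp := LamP; have hp := HP; have d1 := D1; have d2 := D2.
have bf := before; have bo := b_on; move: b_mid; rewrite ler_norml => /andP[bm1 bm2].
have := separation_proj; rewrite ler_norml => /andP[pr1 pr2].
have ze : mdist z e <= `|x1 z - x1 b| + y1 z + 16 * delta.
  have := line_upper L1 z e.
  have := ler_norm (x1 z - x1 b); have := ler_norm (x1 b - x1 z); rewrite (distrC (x1 b)).
  have [[? ->]|[? ->]] := normr_cases (x1 z - x1 e); lra.
have be : mdist b e <= y1 b + 16 * delta.
  by have := line_upper L1 b e; have [[? ->]|[? ->]] := normr_cases (x1 b - x1 e); lra.
have zb : `|x1 z - x1 b| + y1 z + y1 b - 2 * delta <= mdist z b.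
  by have := line_lower L1 z b; lra.
have pe : mdist p e <= y2 p + 6 * Lam + 15 * delta.
  by have := line_upper L1 p e; have [[? ->]|[? ->]] := normr_cases (x1 p - x1 e); lra.
have y2e := line_ge0 L2 e; have y2b := line_ge0 L2 b.
have x2e : x2 e - x2 p <= 6 * Lam + 17 * delta.
  by have := line_lower L2 p e; have [[? ->]|[? ->]] := normr_cases (x2 p - x2 e); lra.
have y1b : x2 b - x2 e + y2 e - 18 * delta <= y1 b.
  by have := line_lower L2 b e; have [[? ->]|[? ->]] := normr_cases (x2 b - x2 e); lra.
rewrite leNgt; apply/negP => V.
have ze2 := line_lower L2 z e; have zb2 := line_upper L2 z b.
rewrite ger0_norm in ze2; last lra.
by have [[? E1]|[? E1]] := normr_cases (x2 z - x2 b); rewrite E1 in zb2; lra.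
Qed.

End Increasing.
(** The term [mdist b q - mdist p q] does not depend on the line: heights above [p] and above [b]
    order the lines alike. *)
Lemma height_diff x y p q b : line_coordinates delta x y ->
  H / 4 <= `|x q - x p| -> `|x b - x p| <= delta ->
  `|y b - y p - (mdist b q - mdist p q)| <= 5 * delta.
Proof.
move=> L D pb; have d0 := delta0; have lp := LamP; have hp := HP.
have n1 := ler_distD (x b) (x q) (x p); have n2 := ler_distD (x p) (x q) (x b).
rewrite (distrC (x p) (x b)) in n2.
have u1 := line_upper L b q; have u2 := line_upper L p q.
have l1 := line_lower L b q; have l2 := line_lower L p q.
rewrite (distrC (x b) (x q)) in u1 l1; rewrite (distrC (x p) (x q)) in u2 l2.
by rewrite ler_norml; case: l1 l2 => [?|?] [?|?]; lra.
Qed.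

End Separation.

(** Words of equal length suffice to count products of [n] generators. *)
Definition free_on (G : groupType) (U : seq G) : Prop := forall s t : seq G,
  {subset s <= U} -> {subset t <= U} -> size s = size t ->
  (\prod_(g <- s) g)%g = (\prod_(g <- t) g)%g -> s = t.

Lemma subset_map (T1 T2 : eqType) (f : T1 -> T2) (U : seq T1) (s : seq T2) :
  {subset s <= map f U} -> exists2 s0, {subset s0 <= U} & s = map f s0.
Proof.
elim: s => [|b s IH] sub; first by exists [::].
have /mapP[a aU ->] := sub b (mem_head _ _).
have [|s0 s0U ->] := IH; first by move=> z zs; apply: sub; rewrite inE zs orbT.
by exists (a :: s0) => // z; rewrite inE => /orP[/eqP ->|/s0U].
Qed.

Lemma free_on_map (T : eqType) (G : groupType) (f : T -> G) (U : seq T) : uniq U ->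
  (forall s t, {subset s <= U} -> {subset t <= U} -> size s = size t ->
    (\prod_(a <- s) f a)%g = (\prod_(a <- t) f a)%g -> s = t) ->
  uniq (map f U) /\ free_on (map f U).
Proof.
move=> uU H; split.
  rewrite map_inj_in_uniq // => a b aU bU fab.
  have sa z : z \in U -> {subset [:: z] <= U} by move=> zU w; rewrite inE => /eqP ->.
  have : [:: a] = [:: b] by apply: H; rewrite ?big_seq1 //; exact: sa.
  by case.
by move=> s t /subset_map[s0 s0U ->] /subset_map[t0 t0U ->]; rewrite !size_map !big_map => st /H ->.
Qed.

Definition conj_power (G : groupType) (h : G) (N : nat) (b : bool) (t : G) : G :=
  (t * hpow h b N * t^-1)%g.

Section PingPong.
Context {R : realType} {X : metricType R} {G : groupType} {act : G -> X -> X}.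
Context {delta lam : R} {D : R -> R} {h : G} {gam : set X} {x y : X -> R} (N : nat).
Hypothesis W : wpd_axis act delta lam D h gam x y.
Hypothesis H4 : @four_point R X delta.

Let G_act := wpd_act W.
Let ax := wpd_coordinates W.

Local Notation xc t p := (x (act t^-1%g p)).
Local Notation yc t p := (y (act t^-1%g p)).
Local Notation Lam := (D (200 * delta) * lam).
Local Notation H := (N%:R * lam).
Hypothesis HP : 1000 * Lam <= H.

Local Notation twist := (conj_power h N).

Lemma twistV b t : (twist b t)^-1%g = twist (~~ b) t.
Proof. by rewrite /conj_power !invgM invgK hpowV mulgA. Qed.

Lemma constants : [/\ 0 < delta, 180 * delta <= Lam & 1000 * delta <= H].
Proof. by have := wpd_delta W; have := Lam_ge W; have := HP; split; lra. Qed.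

Lemma twist_leg b t p : let w := act (twist b t) p in
  [/\ `|xc t w - xc t p - signed b H| <= 2 * delta, `|yc t w - yc t p| <= 2 * delta,
   H + 2 * yc t p - 6 * delta <= mdist w p & mdist w p <= H + 2 * yc t p + 6 * delta].
Proof.
have [d0 _ hp] := constants.
have := xc_conj W t b N p; have := yc_conj W t b N p; rewrite -/(conj_power h N b t).
move=> /=; set w := act _ p => yw xw; split => //.
- have := line_lower (linec W t) w p; move: xw yw; rewrite /signed !ler_norml /=.
  by have [[? ->]|[? ->]] := normr_cases (xc t w - xc t p); case: (b); lra.
- have := line_upper (linec W t) w p; move: xw yw; rewrite /signed !ler_norml /=.
  by have [[? ->]|[? ->]] := normr_cases (xc t w - xc t p); case: (b); lra.
Qed.

(** The path from [p] descends to the line, follows it for [H] in direction [b], and climbs again;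
    that to [q] parts from it after at most [m] along the line. *)
Lemma twist_gp b t p q m : 0 <= m -> m <= H / 2 ->
  signed b (xc t q - xc t p) <= m ->
  gromov_product p (act (twist b t) p) q <= yc t p + m + 7 * delta.
Proof.
have [d0 _ hp] := constants; move=> m0 mH xq.
have [] := twist_leg b t p; set w := act _ p; move=> xw yw _ wp.
have := line_lower (linec W t) w q; have := line_upper (linec W t) q p => /=.
have := line_ge0 (linec W t) q => /=.
move: xw yw xq; rewrite /gromov_product /signed !ler_norml.
have [[? ->]|[? ->]] := normr_cases (xc t q - xc t p);
have [[? ->]|[? ->]] := normr_cases (xc t w - xc t q); case: (b); lra.
Qed.

Lemma pingpong_antichain o (L : seq G) : uniq L ->
  (let far t t' := yc t o <= yc t' o /\
     forall b, `|xc t (act (twist b t') o) - xc t o| < H / 4 in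
   {in L &, forall t t', t != t' -> far t t' \/ far t' t}) ->
  uniq (map (twist true) L) /\ free_on (map (twist true) L).
Proof.
move=> uL far; have [d0 _ hp] := constants.
(* Half the displacement, less the [2 * delta] required by [length_ge] and some slack: any two paths
   must part before their middles. *)
pose r t := mdist (act (twist true t) o) o / 2 - 3 * delta.
have rP t : H / 2 + yc t o - 6 * delta <= r t.
  by have [_ _ ? _] := twist_leg true t o; rewrite /r; lra.
have y0 t : 0 <= yc t o := line_ge0 (linec W t) o.
have close b b' t t' : yc t o <= yc t' o -> `|xc t (act (twist b' t') o) - xc t o| < H / 4 ->
    let gp := gromov_product o (act (twist b t) o) (act (twist b' t') o) in
    gp <= r t /\ gp <= r t'.
  move=> yy; rewrite ltr_norml => /andP[x1 x2] /=.
  have := @twist_gp b t o (act (twist b' t') o) (H / 4).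
  have -> : signed b (xc t (act (twist b' t') o) - xc t o) <= H / 4.
    by rewrite /signed; case: (b); lra.
  have -> : 0 <= H / 4 by lra.
  have -> : H / 4 <= H / 2 by lra.
  by move=> /(_ isT isT isT); have := rP t; have := rP t'; lra.
have close2 b b' t t' : t \in L -> t' \in L -> t != t' ->
    let gp := gromov_product o (act (twist b t) o) (act (twist b' t') o) in
    gp <= r t /\ gp <= r t'.
  move=> tL t'L /(far _ _ tL t'L)[[yy xx]|[yy xx]]; first exact: close.
  by rewrite /= gpC and_comm; exact: close.
apply: free_on_map => // s t sL tL st E.
move: s t sL tL st E.
suff FW : forall s t, {subset s <= L} -> {subset t <= L} -> size s = size t ->
    (\prod_(a <- s) evw (twist true) [:: a])%g = (\prod_(a <- t) evw (twist true) [:: a])%g ->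
    s = t.
  move=> s t sL tL st E; apply: FW => //.
  by rewrite /evw; under eq_bigr do rewrite big_seq1; under [RHS]eq_bigr do rewrite big_seq1.
apply: (@free_words _ _ _ act delta o G (twist true) r r (fun _ _ => true) d0 H4 G_act
  L _ _ L [::]) => //.
- move=> a aL; split; first by have := rP a; have := y0 a; lra.
  by rewrite /r; lra.
- move=> a b aL bL _; rewrite twistV /=.
  have [<-|ab] := eqVneq a b; last exact: close2.
  have := @twist_gp false a o (act (twist true a) o) 0 (lexx _).
  have -> : 0 <= H / 2 by lra.
  have -> : signed false (xc a (act (twist true a) o) - xc a o) <= 0.
    have [+ _ _ _] := twist_leg true a o; rewrite /signed ler_norml; lra.
  by move=> /(_ isT isT); have := rP a; lra.
- by move=> a b aL bL ab; exact: close2.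
Qed.

Let cst := constants.

Local Notation ascends t p q := (xc t p <= xc t q).

Lemma dense_conj t v : exists m, `|xc t m - v| <= 6 * delta /\ yc t m <= 7 * delta.
Proof.
have [m [_ xm ym]] := axis_dense ax v.
by exists (act t m); rewrite (actK G_act).
Qed.

(** Otherwise the overlap would be [5 * Lam], as the second interval is itself longer than that. *)
Lemma before_of_overlap t t' p q : ~ elementary h (t^-1 * t')%g -> yc t p <= yc t' p ->
  H / 4 <= `|xc t q - xc t p| -> H / 4 <= `|xc t' q - xc t' p| ->
  yc t p + `|xc t q - xc t p| <= yc t' p + 5 * Lam.
Proof.
move=> ne yy D1 D2; have [d0 lp hp] := cst; have hp' := HP.
rewrite leNgt; apply/negP => big.
have := overlap W (t := t) (t' := t') (p := p) (q := q)
  (lo := yc t' p) (hi := yc t' p + 5 * Lam) ne yy (lexx _).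
have h1 : yc t' p + 5 * Lam <= yc t p + `|xc t q - xc t p| by lra.
have h2 : yc t' p + 5 * Lam <= yc t' p + `|xc t' q - xc t' p| by lra.
by move=> /(_ h1 h2); rewrite ltxx.
Qed.

(** Signs reduce this to increasing coordinates. The allowance [6 * Lam], not [5 * Lam], lets
    [separation_rev] exchange [p] and [q], which costs [4 * delta]. *)
Lemma separation t t' p q b :
  H / 4 <= `|xc t q - xc t p| -> H / 4 <= `|xc t' q - xc t' p| ->
  yc t p + `|xc t q - xc t p| <= yc t' p + 6 * Lam ->
  yc t' b <= 7 * delta -> `|xc t' b - (xc t' p + xc t' q) / 2| <= 6 * delta ->
  `|xc t b - xc t q| <= delta /\
  forall z, H / 2 <= `|xc t z - xc t b| ->
    signed (ascends t' p q) (xc t' z - xc t' b) <= - (H / 16).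
Proof.
move=> D1 D2 bef yb mid; have [d0 lp hp] := cst.
have L c s := line_signed c (linec W s).
have asc s : `|xc s q - xc s p| = signed (ascends s p q) (xc s q) - signed (ascends s p q) (xc s p).
  rewrite /signed; case: ifP => [?|/negbT]; first by rewrite ger0_norm // subr_ge0.
  by rewrite -ltNge => ?; rewrite ltr0_norm ?subr_lt0 //; lra.
have absS c (u : R) : `|signed c u| = `|u| by case: c; rewrite /signed ?normrN.
have subS c (u v : R) : signed c u - signed c v = signed c (u - v).
  by case: c; rewrite /signed ?opprB; lra.
rewrite asc in D1 bef; rewrite asc in D2.
have mid' : `|signed (ascends t' p q) (xc t' b) -
    (signed (ascends t' p q) (xc t' p) + signed (ascends t' p q) (xc t' q)) / 2| <= 6 * delta.
  by move: mid; rewrite !ler_norml /signed; case: (ascends t' p q); lra.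
have [e [xe ye]] := dense_conj t (xc t q).
have pr := separation_proj d0 lp HP (L _ t) (L _ t') D1 D2 bef yb mid'.
rewrite subS absS in pr; split => // z zb.
rewrite -subS; apply: (separation_side d0 lp HP (L _ t) (L _ t') D1 D2 bef yb mid' ye) => //.
  by rewrite subS absS.
by rewrite subS absS.
Qed.

Lemma separation_rev t t' p q b :
  H / 4 <= `|xc t q - xc t p| -> H / 4 <= `|xc t' q - xc t' p| ->
  yc t' p + `|xc t' q - xc t' p| <= yc t p + 5 * Lam ->
  yc t' b <= 7 * delta -> `|xc t' b - (xc t' p + xc t' q) / 2| <= 6 * delta ->
  `|xc t b - xc t p| <= delta /\
  forall z, H / 2 <= `|xc t z - xc t b| ->
    H / 16 <= signed (ascends t' p q) (xc t' z - xc t' b).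
Proof.
move=> D1 D2 bef yb mid; have [d0 lp hp] := cst.
have ends s : H / 4 <= `|xc s q - xc s p| ->
    `|mdist p q - (yc s p + `|xc s q - xc s p| + yc s q)| <= 2 * delta.
  move=> Ds; rewrite ler_norml; have := line_upper (linec W s) p q => /=.
  have := line_lower (linec W s) p q => /=; rewrite (distrC (xc s p)) => -[?|?] ?; lra.
have := ends _ D1; rewrite ler_norml => /andP[a1 a2].
have := ends _ D2; rewrite ler_norml => /andP[b1 b2].
have D1' := D1; rewrite distrC in D1'; have D2' := D2; rewrite distrC in D2'.
have bef' : yc t q + `|xc t p - xc t q| <= yc t' q + 6 * Lam by rewrite distrC; lra.
rewrite (addrC (xc t' p)) in mid.
have [pr side] := separation D1' D2' bef' yb mid.
split => // z /side; rewrite /signed.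
case: (lerP (xc t' p) (xc t' q)) => [|/ltW ->]; last lra.
case: ifP => [qp pq|]; last lra.
by exfalso; move: D2; rewrite ler0_norm; lra.
Qed.

Lemma cross_gp c t b z z' : yc t b <= 7 * delta ->
  signed c (xc t z - xc t b) <= - (H / 16) -> H / 16 <= signed c (xc t z' - xc t b) ->
  gromov_product b z z' <= 10 * delta.
Proof.
move=> yb; have [d0 lp hp] := cst; rewrite /gromov_product /signed.
have := line_lower (linec W t) z z' => /=.
have := line_upper (linec W t) z b; have := line_upper (linec W t) z' b => /=.
case: c => /= + + + h1 h2.
  rewrite (@ler0_norm _ (xc t z - _)) ?(@ger0_norm _ (xc t z' - _)); [|lra..].
  by rewrite (@ler0_norm _ (xc t z - xc t z')); lra.
rewrite (@ger0_norm _ (xc t z - _)) ?(@ler0_norm _ (xc t z' - _)); [|lra..].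
by rewrite (@ger0_norm _ (xc t z - xc t z')); lra.
Qed.

Lemma twist_far b s c z b' : `|xc s b' - xc s z| <= delta -> `|xc s b - xc s z| <= delta ->
  H / 2 <= `|xc s (act (twist c s) b) - xc s b'|.
Proof.
move=> e2 e3; have [d0 _ hp] := cst; have [e1 _ _ _] := twist_leg c s b.
have hH : H <= `|signed c H| by rewrite /signed; case: (c); rewrite ?normrN ler_norm.
move: e1; set w := xc s (act _ b) => e1.
have n1 := ler_distD (w - xc s b) (signed c H) 0; rewrite !subr0 in n1.
have n2 := ler_distD (xc s b') w (xc s b); have n3 := ler_distD (xc s z) (xc s b') (xc s b).
rewrite (distrC (xc s z)) in n3.
by rewrite (distrC (signed c H)) in n1; lra.
Qed.

(* All lines follow the geodesic from [p] to [q] in turn. Seen from a point [b] in the middle of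
   the second one, the first line is on one side and those of [J] on the other; the conjugates
   attached to [J] translate backwards, so that their paths from [b] diverge. *)
Lemma pingpong_chain p q t1 t2 (J : seq G) : uniq J ->
  {in t1 :: t2 :: J, forall t, H / 4 <= `|xc t q - xc t p|} ->
  yc t1 p <= yc t2 p -> {in J, forall t, yc t2 p <= yc t p} ->
  ~ elementary h (t1^-1 * t2)%g -> {in J, forall t, ~ elementary h (t2^-1 * t)%g} ->
  {in J &, forall t t', t != t' -> ~ elementary h (t^-1 * t')%g} ->
  let w t := (twist (~~ ascends t p q) t * twist true t1)%g in
  uniq (map w J) /\ free_on (map w J).
Proof.
move=> uJ big y12 y2J n12 n2J nJ w; have [d0 lp hp] := cst; have hp' := HP.
have H2 : 0 <= H / 2 by lra.
have big1 : H / 4 <= `|xc t1 q - xc t1 p| by apply: big; rewrite mem_head.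
have big2 : H / 4 <= `|xc t2 q - xc t2 p| by apply: big; rewrite !inE eqxx orbT.
have bigJ t : t \in J -> H / 4 <= `|xc t q - xc t p|.
  by move=> tJ; apply: big; rewrite !inE tJ !orbT.
have y0 t z : 0 <= yc t z := line_ge0 (linec W t) z.
have mid t : exists b, `|xc t b - (xc t p + xc t q) / 2| <= 6 * delta /\ yc t b <= 7 * delta.
  exact: dense_conj _ _.
have [b [bm yb]] := mid t2.
have d00 (u : R) : `|u - u| <= delta by rewrite subrr normr0 ltW.
have bef1 := before_of_overlap n12 y12 big1 big2.
have [proj1 side1] : `|xc t1 b - xc t1 q| <= delta /\
    forall c, signed (ascends t2 p q) (xc t2 (act (twist c t1) b) - xc t2 b) <= - (H / 16).
  have [|pr side] := separation big1 big2 _ yb bm; first lra.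
  by split => // c; apply: side; exact: (@twist_far b t1 c b b).
have sideJ t : t \in J -> `|xc t b - xc t p| <= delta /\
    forall c, H / 16 <= signed (ascends t2 p q) (xc t2 (act (twist c t) b) - xc t2 b).
  move=> tJ; have bef := before_of_overlap (n2J _ tJ) (y2J _ tJ) big2 (bigJ _ tJ).
  have [pr side] := separation_rev (bigJ _ tJ) big2 bef yb bm.
  by split => // c; apply: side; exact: (@twist_far b t c b b).
have cross t c c' : t \in J ->
    gromov_product b (act (twist c t1) b) (act (twist c' t) b) <= 10 * delta.
  by move=> tJ; have [_ sj] := sideJ t tJ; exact: (cross_gp yb (side1 c) (sj c')).
(* On the line of [t], the conjugate at [t'] sends [b] beyond the middle [b'] towards [q], while the
   conjugate at [t] moves it the other way: [twist_gp] applies with [m = 0]. *)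
have div t t' c : t \in J -> t' \in J -> t != t' -> yc t p <= yc t' p ->
    gromov_product b (act (twist (~~ ascends t p q) t) b) (act (twist c t') b)
      <= yc t b + 7 * delta.
  move=> tJ t'J tt' yy.
  have [b' [bm' yb']] := mid t.
  have [pr side] := separation_rev (bigJ _ t'J) (bigJ _ tJ)
    (before_of_overlap (nJ _ _ tJ t'J tt') yy (bigJ _ tJ) (bigJ _ t'J)) yb' bm'.
  have [prb' _] := sideJ t' t'J; have [prb _] := sideJ t tJ.
  have := side _ (twist_far c pr prb') => {}side.
  have := @twist_gp (~~ ascends t p q) t b (act (twist c t') b) 0 (lexx _).
  rewrite H2.
  have -> : signed (~~ ascends t p q) (xc t (act (twist c t') b) - xc t b) <= 0.
    have := bigJ t tJ.
    move: bm' prb side; rewrite /signed !ler_norml.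
    case: (lerP (xc t p) (xc t q)) => /=; lra.
  by move=> /(_ isT isT); rewrite addr0.
have height t t' : t \in J -> t' \in J -> yc t p <= yc t' p -> yc t b <= yc t' b + 10 * delta.
  move=> tJ t'J; have [prb' _] := sideJ t' t'J; have [prb _] := sideJ t tJ.
  have := height_diff d0 lp HP (linec W t) (bigJ t tJ) prb.
  have := height_diff d0 lp HP (linec W t') (bigJ t' t'J) prb'.
  rewrite !ler_norml /=; lra.
(* [None] is the common second factor. Admissible words alternate, so consecutive letters lie on
   opposite sides of [b], where [cross] applies; the [20 * delta] in [r] cover [7 * delta] from
   [div] and [10 * delta] from [height]. *)
pose ev (l : option G) := if l is Some t then twist (~~ ascends t p q) t else twist true t1.
pose r (l : option G) := if l is Some t then yc t b + 20 * delta else 30 * delta.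
pose adm (l l' : option G) := (l == None) (+) (l' == None).
apply: free_on_map => // s t sJ tJ st E.
suff : map Some s = map Some t by move=> /inj_map; apply; exact: Some_inj.
pose U := map Some J.
have sub v : {subset v <= J} -> {subset map Some v <= U}.
  by move=> vJ _ /mapP[z /vJ zJ ->]; exact: map_f.
apply: (@free_words _ _ _ act delta b _ ev r (fun=> 30 * delta) adm d0 H4 G_act
  (None :: U) _ _ U [:: None]); [| |
   by move=> z zU; rewrite inE zU orbT|by move=> z; rewrite !inE => ->| |
   |exact: sub|exact: sub|by rewrite !size_map|].
- move=> l; rewrite inE => /orP[/eqP ->|/mapP[z zJ ->]] /=; split; try lra.
    by have [_ _ ? _] := twist_leg true t1 b; have := y0 t1 b; lra.
  by have [_ _ ? _] := twist_leg (~~ ascends z p q) z b; have := y0 z b; lra.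
- move=> l l'; rewrite !inE => /orP[/eqP ->|/mapP[z zJ ->]] /orP[/eqP ->|/mapP[z' z'J ->]] //= _;
    rewrite twistV.
    by have := cross _ (~~ true) (~~ ascends z' p q) z'J; have := y0 z' b; lra.
  by rewrite gpC; have := cross _ true (~~ ~~ ascends z p q) zJ; lra.
- move=> _ _ /mapP[z zJ ->] /mapP[z' z'J ->] zz' /=.
  have {}zz' : z != z' by apply: contra_neq zz' => ->.
  have [yy|/ltW yy] := lerP (yc z p) (yc z' p).
    have := div _ _ (~~ ascends z' p q) zJ z'J zz' yy; have := height _ _ zJ z'J yy; lra.
  rewrite eq_sym in zz'; rewrite gpC.
  have := div _ _ (~~ ascends z p q) z'J zJ zz' yy; have := height _ _ z'J zJ yy; lra.
- by move=> _ _ /mapP[z _ ->] /mapP[z' _ ->].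
- rewrite !big_map; have evE z : evw ev [:: Some z; None] = w z.
    by rewrite /evw !big_cons big_nil mulg1.
  by under eq_bigr do rewrite evE; under [RHS]eq_bigr do rewrite evE.
Qed.

End PingPong.

(** * Growth *)

Section Roots.
Context {R : realType}.
Implicit Types (t : R) (a n : nat).

Lemma powR_rootK a n : (0 < n)%N -> (a%:R `^ n%:R^-1) ^+ n = a%:R :> R.
Proof.
move=> n0; rewrite -powR_mulrn ?powR_ge0 // -powRrM mulVf ?powRr1 //.
by rewrite pnatr_eq0 -lt0n.
Qed.

Lemma powR_root_le a n t : (0 < n)%N -> 0 <= t -> (a%:R `^ n%:R^-1 <= t) = (a%:R <= t ^+ n).
Proof. by move=> n0 t0; rewrite -[in RHS](powR_rootK a n0) ler_pXn2r // nnegrE ?powR_ge0. Qed.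

Lemma powR_root_ge a n t : (0 < n)%N -> 0 <= t -> (t <= a%:R `^ n%:R^-1) = (t ^+ n <= a%:R).
Proof. by move=> n0 t0; rewrite -[in RHS](powR_rootK a n0) ler_pXn2r // nnegrE ?powR_ge0. Qed.

Lemma bernoulli_le t n : 0 <= t -> 1 + n%:R * t <= (1 + t) ^+ n.
Proof.
move=> t0; elim: n => [|n IH]; first by rewrite mul0r addr0 expr0.
rewrite exprS; apply: le_trans (_ : (1 + t) * (1 + n%:R * t) <= _); last first.
  by apply: ler_wpM2l => //; lra.
have : 0 <= n%:R * t * t by rewrite !mulr_ge0.
by rewrite -(natr1 n); lra.
Qed.

Section Submultiplicative.
Variable a : nat -> nat.
Hypothesis a_gt0 : forall n, (0 < a n)%N.
Hypothesis aD : forall n m, (a (n + m) <= a n * a m)%N.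

Lemma submul_pow n k : (0 < k)%N -> (a (k * n) <= a n ^ k)%N.
Proof.
elim: k => // -[_|k IH _]; first by rewrite mul1n expn1.
by rewrite mulSn expnS; apply: leq_trans (aD _ _) _; rewrite leq_mul2l IH // orbT.
Qed.

(* Fekete's lemma *)
Lemma cvg_submultiplicative_root : cvgn (fun n : nat => (a n)%:R `^ n%:R^-1 : R).
Proof.
pose v n : R := (a n)%:R `^ n%:R^-1.
have v1 n : (0 < n)%N -> 1 <= v n.
  by move=> n0; rewrite /v powR_root_ge // expr1n ler1n.
pose A := [set v n | n in [set n | (0 < n)%N]].
have Ainf : has_inf A.
  split; first by exists (v 1%N); exists 1%N.
  by exists 1 => _ [n n0 <-]; exact: v1.
apply/cvg_ex; exists (inf A); apply/cvgrPdist_le => e e0.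
have L1 : 1 <= inf A by apply: lb_le_inf; [case: Ainf|move=> _ [n n0 <-]; exact: v1].
(* Chosen so that [(inf A + e1) * (1 + e1) <= inf A + e]; the factor [1 + e1] absorbs the remainder
   of the division by [m]. *)
pose e1 := Num.min 1 (e / (inf A + 3)).
have den0 : 0 < inf A + 3 by lra.
have e10 : 0 < e1 by rewrite lt_min ltr01 divr_gt0.
have e1_le1 : e1 <= 1 by rewrite ge_min lexx.
have e1_le : e1 * (inf A + 3) <= e by rewrite -ler_pdivlMr // ge_min lexx orbT.
have [_ [m m0 <-] vm] := inf_adherent e10 Ainf.
set t := inf A + e1 in vm.
have t1 : 1 <= t by rewrite /t; lra.
have am : (a m)%:R <= t ^+ m by rewrite -powR_root_le ?ltW //; lra.
have [C HC] := finite_upper_bound (fun s => (a s)%:R : R) m.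
near=> n.
have n0 : (0 < n)%N by near: n; exact: nbhs_infty_gt.
have Cn : C <= 1 + n%:R * e1.
  have : C / e1 <= n%:R by near: n; exact: nbhs_infty_ger.
  by rewrite ler_pdivrMr //; lra.
have lo : inf A <= v n by apply: ge_inf; [case: Ainf|exists n].
rewrite distrC ger0_norm ?subr_ge0 // -/(v n).
have up : v n <= t * (1 + e1).
  rewrite /v powR_root_le //; last by rewrite mulr_ge0 //; lra.
  have aq q r : (a (q * m + r))%:R <= t ^+ (q * m) * (a r)%:R.
    elim: q => [|q IH]; first by rewrite mul0n expr0 mul1r.
    rewrite mulSn -addnA exprD -mulrA; apply: le_trans (ler_pM _ _ am IH) => //.
    by rewrite -natrM ler_nat.
  rewrite (divn_eq n m) exprMn; apply: le_trans (aq _ _) _; rewrite -divn_eq.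
  apply: ler_pM => //; first by rewrite exprn_ge0 //; lra.
    by rewrite ler_weXn2l // leq_trunc_div.
  apply: le_trans (HC _ (ltn_pmod n m0)) _; apply: le_trans Cn _.
  by apply: bernoulli_le; exact: ltW.
have : e1 * (t + 1) <= e1 * (inf A + 3) by rewrite ler_pM2l // /t; lra.
have : t * (1 + e1) = inf A + e1 * (t + 1) by rewrite /t; ring.
lra.
Unshelve. all: by end_near.
Qed.

End Submultiplicative.
End Roots.

Section Balls.
Context {G : groupType} (S : {fset G}).

Lemma word_ball_prod n (w : seq G) : {subset w <= S} -> (size w <= n)%N ->
  word_ball S n (\prod_(s <- w) s)%g.
Proof. by exists w. Qed.

Lemma word_ballM n m g k : word_ball S n g -> word_ball S m k -> word_ball S (n + m) (g * k)%g.
Proof.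
move=> [w [wn wS <-]] [v [vm vS <-]]; exists (w ++ v); rewrite size_cat big_cat; split => //.
  exact: leq_add.
by move=> z; rewrite mem_cat => /orP[/wS|/vS].
Qed.

Lemma word_ball_split n m g : word_ball S (n + m) g ->
  exists k l, [/\ word_ball S n k, word_ball S m l & g = (k * l)%g].
Proof.
move=> [w [wn wS <-]]; exists (\prod_(s <- take n w) s)%g, (\prod_(s <- drop n w) s)%g; split.
- apply: word_ball_prod; last by rewrite size_take_min geq_minl.
  by move=> z /mem_take /wS.
- apply: word_ball_prod; last by rewrite size_drop leq_subLR.
  by move=> z /mem_drop /wS.
- by rewrite -big_cat cat_take_drop.
Qed.

Lemma word_ball1 n : word_ball S n 1%g.
Proof. by exists [::]; rewrite big_nil. Qed.

Lemma word_ball_gen s : s \in S -> word_ball S 1 s.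
Proof.
move=> sS; exists [:: s]; rewrite big_seq1; split => // z; rewrite inE => /eqP -> //.
Qed.

Lemma word_ball_le n m g : (n <= m)%N -> word_ball S n g -> word_ball S m g.
Proof. by move=> nm [w [wn wS <-]]; exists w; split => //; exact: leq_trans nm. Qed.

Lemma word_ballX n g k : word_ball S n g -> word_ball S (n * k) (g ^+ k)%g.
Proof.
move=> gn; elim: k => [|k IH]; first by rewrite expg0; exact: word_ball1.
by rewrite expgS mulnS; exact: word_ballM.
Qed.

Lemma word_ballV n g : (forall s, s \in S -> (s^-1)%g \in S) ->
  word_ball S n g -> word_ball S n (g^-1)%g.
Proof.
move=> SV [w [wn wS <-]]; exists (rev [seq (s^-1)%g | s <- w]).
rewrite size_rev size_map; split => //.
  by move=> z; rewrite mem_rev => /mapP[s /wS sS ->]; exact: SV.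
elim: w {wn wS} => [|s w IH]; first by rewrite /= !big_nil invg1.
by rewrite /= rev_cons -cats1 big_cat big_seq1 /= big_cons invgM -IH.
Qed.

Lemma word_ball_seq n : exists s : seq G, forall g, word_ball S n g -> g \in s.
Proof.
elim: n => [|n [s IH]].
  by exists [:: 1%g] => g [w [+ _ <-]]; rewrite leqn0 size_eq0 => /eqP ->; rewrite big_nil inE.
exists [seq (g * k)%g | g <- 1%g :: enum_fset S, k <- s] => g.
rewrite -addn1 addnC => /word_ball_split[k [l [[w [w1 wS <-]] /IH ls ->]]].
apply/allpairsP; exists ((\prod_(s <- w) s)%g, l); split => //.
case: w w1 wS => [|z [|//]] _ wS; first by rewrite big_nil mem_head.
by rewrite big_seq1 inE wS ?orbT // mem_head.
Qed.

Lemma finite_word_ball n : finite_set (word_ball S n).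
Proof.
have [s sP] := word_ball_seq n.
by apply: sub_finite_set (finite_seq s) => g /sP.
Qed.

Definition ball_size n := #|` fset_set (word_ball S n)|.

Lemma mem_word_ball n g : (g \in fset_set (word_ball S n)) = `[< word_ball S n g >].
Proof. by rewrite in_fset_set //; exact: finite_word_ball. Qed.

Lemma ball_size_gt0 n : (0 < ball_size n)%N.
Proof.
rewrite cardfs_gt0; apply/fset0Pn; exists 1%g; rewrite mem_word_ball.
by apply/asboolP; exact: word_ball1.
Qed.

Lemma ball_sizeD n m : (ball_size (n + m) <= ball_size n * ball_size m)%N.
Proof.
pose E k := enum_fset (fset_set (word_ball S k)).
have -> : (ball_size n * ball_size m = size [seq (g * k)%g | g <- E n, k <- E m])%N.
  by rewrite size_allpairs.
apply: uniq_leq_size; first exact: fset_uniq.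
move=> g; rewrite mem_word_ball => /asboolP/word_ball_split[k [l [kn lm ->]]].
by apply/allpairsP; exists (k, l); rewrite !mem_word_ball; split => //; exact/asboolP.
Qed.

Lemma ball_size_ge n (s : seq G) : uniq s -> {in s, forall g, word_ball S n g} ->
  (size s <= ball_size n)%N.
Proof. by apply: size_le_card_fset_set; exact: finite_word_ball. Qed.

(** [k ^ n <= ball_size (n * l) <= ball_size n ^ l] gives a bound at every [n], not only at
    multiples of [l]. *)
Lemma growth_rate_ge (R : realType) l k : (0 < l)%N ->
  (forall n, (k ^ n <= ball_size (n * l))%N) -> k%:R `^ l%:R^-1 <= growth_rate R S.
Proof.
move=> l0 kl; apply: limr_ge.
  exact: (cvg_submultiplicative_root ball_size_gt0 ball_sizeD).
near=> n; have n0 : (0 < n)%N by near: n; exact: nbhs_infty_gt.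
rewrite powR_root_ge ?powR_ge0 // -/(ball_size n).
rewrite -(@ler_pXn2r R l) ?nnegrE ?exprn_ge0 ?powR_ge0 //.
rewrite -exprM mulnC exprM powR_rootK //.
rewrite -!natrX ler_nat; apply: leq_trans (kl n) _; rewrite mulnC.
exact: submul_pow ball_sizeD _ _ l0.
Unshelve. all: by end_near.
Qed.

End Balls.

(** * Extraction of a free semigroup *)

Lemma pigeonhole_cover (T I : eqType) (P : I -> T -> Prop) (B : nat) (J : seq I) (s : seq T) :
  uniq s -> {in s, forall g, exists2 i, i \in J & P i g} ->
  {in J, forall i (s' : seq T), uniq s' -> {subset s' <= s} -> {in s', forall g, P i g} ->
    (size s' <= B)%N} ->
  (size s <= size J * B)%N.
Proof.
elim: J s => [|i J IH] s us cov small.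
  case: s us cov {small} => // g s _ cov.
  by have [] := cov g (mem_head _ _).
rewrite /= mulSn -(count_predC (fun g => `[< P i g >]) s) -!size_filter; apply: leq_add.
  apply: (small i (mem_head _ _)); first exact: filter_uniq.
    by move=> g; rewrite mem_filter => /andP[].
  by move=> g; rewrite mem_filter => /andP[/asboolP].
apply: IH; first exact: filter_uniq.
  move=> g; rewrite mem_filter => /andP[/asboolPn nP /cov[j +]].
  by rewrite inE => /orP[/eqP -> //|jJ Pj]; exists j.
move=> j jJ s' us' sub; apply: small => //; first by rewrite inE jJ orbT.
by move=> g /sub; rewrite mem_filter => /andP[].
Qed.

Lemma exists_transversal (T : eqType) (E : T -> T -> Prop) (s : seq T) :
  (forall g, E g g) -> (forall g k, E g k -> E k g) -> uniq s ->
  exists t, [/\ uniq t, {subset t <= s}, {in t &, forall g k, g != k -> ~ E g k} &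
    {in s, forall g, exists2 k, k \in t & E k g}].
Proof.
move=> Er Es; elim: s => [|g s IH] /=; first by exists [::].
move=> /andP[gs us]; have [t [ut ts tE tc]] := IH us.
have ts' : {subset t <= g :: s} by move=> z /ts zs; rewrite inE zs orbT.
have [[k kt Ekg]|nE] := pselect (exists2 k, k \in t & E k g).
  exists t; split => // z; rewrite inE => /orP[/eqP ->|/tc //].
  by exists k.
exists (g :: t); split.
- by rewrite /= ut andbT; apply: contra gs => /ts.
- by move=> z; rewrite !inE => /orP[->//|/ts ->]; rewrite orbT.
- move=> z w; rewrite !inE => /orP[/eqP ->|zt] /orP[/eqP ->|wt]; rewrite ?eqxx //.
  + by move=> _ Egw; apply: nE; exists w => //; exact: Es.
  + by move=> _ Ezg; apply: nE; exists z.
  + exact: tE.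
- move=> z; rewrite inE => /orP[/eqP ->|/tc[k kt Ekz]]; first by exists g => //; rewrite mem_head.
  by exists k => //; rewrite inE kt orbT.
Qed.

(* [Q] is only used in the direction of increasing [d], which makes it acyclic. *)
Lemma exists_kernel (R : realDomainType) (T : eqType) (d : T -> R) (Q : T -> T -> Prop)
    (s : seq T) :
  uniq s -> exists t, [/\ uniq t, {subset t <= s},
    {in t &, forall g k, g != k -> (d g <= d k /\ ~ Q g k) \/ (d k <= d g /\ ~ Q k g)} &
    {in s, forall g, g \in t \/ exists2 k, k \in t & Q g k}].
Proof.
pose le g k := d g <= d k.
have le_tr : transitive le by move=> a b c; exact: le_trans.
have le_tot : total le by move=> a b; exact: le_total.
suff H s1 : sorted le s1 -> uniq s1 -> exists t, [/\ uniq t, {subset t <= s1},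
    {in t &, forall g k, g != k -> (d g <= d k /\ ~ Q g k) \/ (d k <= d g /\ ~ Q k g)} &
    {in s1, forall g, g \in t \/ exists2 k, k \in t & Q g k}].
  move=> us; have [|t [ut ts tQ tc]] := H (sort le s) (sort_sorted le_tot s).
    by rewrite sort_uniq.
  exists t; split => //; first by move=> z /ts; rewrite mem_sort.
  by move=> g gs; apply: tc; rewrite mem_sort.
elim: s1 => [|g s1 IH] /=; first by exists [::].
move=> gs1 /andP[gn us]; have [t [ut ts tQ tc]] := IH (path_sorted gs1) us.
have gle : {in s1, forall k, d g <= d k} by apply/allP; exact: order_path_min gs1.
have ts' : {subset t <= g :: s1} by move=> z /ts zs; rewrite inE zs orbT.
have [[k kt Qgk]|nQ] := pselect (exists2 k, k \in t & Q g k).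
  exists t; split => // z; rewrite inE => /orP[/eqP ->|/tc //].
  by right; exists k.
exists (g :: t); split.
- by rewrite /= ut andbT; apply: contra gn => /ts.
- by move=> z; rewrite !inE => /orP[->//|/ts ->]; rewrite orbT.
- move=> z w; rewrite !inE => /orP[/eqP ->|zt] /orP[/eqP ->|wt]; rewrite ?eqxx //.
  + by move=> _; left; split; [exact/gle/ts|move=> Qgw; apply: nQ; exists w].
  + by move=> _; right; split; [exact/gle/ts|move=> Qgw; apply: nQ; exists z].
  + exact: tQ.
- move=> z; rewrite inE => /orP[/eqP ->|/tc[zt|[k kt Ekz]]].
  + by left; rewrite mem_head.
  + by left; rewrite inE zt orbT.
  + by right; exists k => //; rewrite inE kt orbT.
Qed.

Lemma free_on_ball_size (G : groupType) (S : {fset G}) (U : seq G) (l k : nat) :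
  uniq U -> free_on U -> {in U, forall g, word_ball S l g} -> (k <= size U)%N ->
  forall n, (k ^ n <= ball_size S (n * l))%N.
Proof.
move=> uU freeU Ul kU n.
pose fix words n := if n is m.+1 then [seq u :: w | u <- U, w <- words m] else [:: [::]].
have wordsP m w : w \in words m -> {subset w <= U} /\ size w = m.
  elim: m w => [|m IH] w /=; first by rewrite inE => /eqP ->.
  move=> /allpairsP[[u v] /= [uU' /IH[vU vm] ->]] /=; split; last by rewrite vm.
  by move=> z; rewrite inE => /orP[/eqP ->|/vU].
have words_uniq m : uniq (words m).
  elim: m => //= m IH; apply: allpairs_uniq => // -[u v] [u' v'] _ _ /= [-> ->] //.
have words_size m : size (words m) = (size U ^ m)%N.
  by elim: m => //= m IH; rewrite size_allpairs IH expnS.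
apply: leq_trans (_ : size U ^ n <= _)%N; first by case: n => // n; rewrite leq_exp2r.
have prod_ball w : {subset w <= U} -> word_ball S (size w * l) (\prod_(g <- w) g)%g.
  elim: w => [|u w IH] wU; first by rewrite big_nil; exact: word_ball1.
  rewrite big_cons mulSn; apply: word_ballM; first by apply: Ul; apply: wU; rewrite mem_head.
  by apply: IH => z zw; apply: wU; rewrite inE zw orbT.
rewrite -words_size -(size_map (fun w => \prod_(g <- w) g)%g); apply: ball_size_ge.
  rewrite map_inj_in_uniq // => w v /wordsP[wU wn] /wordsP[vU vn].
  by apply: freeU => //; rewrite wn vn.
by move=> _ /mapP[w /wordsP[wU <-] ->]; exact: prod_ball.
Qed.

Section Assembly.
Context {R : realType} {X : metricType R} {G : groupType} {act : G -> X -> X}.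
Context {delta lam : R} {D : R -> R} {h : G} {gam : set X} {x y : X -> R} (M N : nat).
Context (S : {fset G}).
Hypothesis W : wpd_axis act delta lam D h gam x y.
Hypothesis H4 : @four_point R X delta.
Hypothesis Sgen : generating S.
Hypothesis hM : word_ball S M h.

Local Notation xc t p := (x (act t^-1%g p)).
Local Notation yc t p := (y (act t^-1%g p)).
Local Notation D200 := (D (200 * delta)).
Local Notation H := (N%:R * lam).
Hypothesis HP : 1000 * (D200 * lam) <= H.
Hypothesis nvc : ~ virtually_cyclic G.

Lemma elementary1 : elementary h 1%g.
Proof. by have := elementary_hpow h true 0; rewrite /hpow expg0. Qed.

Lemma exists_nonelementary : exists2 c, c \in S & ~ elementary h c.
Proof.
apply: contrapT => nc; apply: nvc; apply: (elementary_virtually_cyclic W) => t.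
have [_ gen] := Sgen; have [n [w [_ wS <-]]] := gen t.
elim: w wS => [|s w IH] wS; first by rewrite big_nil; exact: elementary1.
rewrite big_cons; apply: elementaryM.
  by apply: contrapT => ns; apply: nc; exists s => //; apply: wS; rewrite mem_head.
by apply: IH => z zw; apply: wS; rewrite inE zw orbT.
Qed.

(** Either [S] meets more than [a = 3 * k ^ 2] cosets of [E], or one coset contains more than
    [a * B] of its elements, and their translates [t^-1 * g * c] are at most [B] to a coset. The
    factor 18 is [3 * 3 * 2]. *)
Lemma exists_lines k : 18 * D200 * k%:R ^+ 4 < #|` S|%:R -> exists T : seq G,
  [/\ uniq T, {in T, forall g, word_ball S 3 g},
      {in T &, forall g g', g != g' -> ~ elementary h (g^-1 * g')%g} & (3 * k ^ 2 < size T)%N].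
Proof.
move=> mk; have [SV _] := Sgen; have [c cS nc] := exists_nonelementary.
pose E g g' := elementary h (g^-1 * g')%g.
have Er g : E g g by rewrite /E mulVg; exact: elementary1.
have Es g g' : E g g' -> E g' g by move=> /elementaryV; rewrite /E invgM invgK.
have D0 : 0 <= D200 by have := @count_commuting _ _ _ _ _ _ _ _ _ _ _ W c [::] nc isT; apply.
have [B /andP[B1 B2]] : exists n : nat, n%:R <= 2 * D200 < n.+1%:R.
  by apply: nat_floor; rewrite mulr_ge0.
set a := (3 * k ^ 2)%N.
have aaB : (a * (a * B) < #|` S|)%N.
  rewrite -(ltr_nat R); apply: le_lt_trans mk.
  have -> : (a * (a * B))%:R = 9 * k%:R ^+ 4 * B%:R :> R.
    by rewrite /a !natrM ?natrX; ring.
  have k4 : 0 <= k%:R ^+ 4 :> R by rewrite exprn_ge0.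
  have : k%:R ^+ 4 * B%:R <= k%:R ^+ 4 * (2 * D200) by apply: ler_wpM2l.
  lra.
have [T1 [uT1 T1s T1E T1c]] := exists_transversal Er Es (fset_uniq S).
have [aT|Ta] := ltnP a (size T1).
  by exists T1; split => // g /T1s gS; apply: (word_ball_le (n := 1)) => //; exact: word_ball_gen.
have [t tT [s' [us' s's s'E aB]]] : exists2 t, t \in T1 & exists s' : seq G,
    [/\ uniq s', {subset s' <= enum_fset S}, {in s', forall g, E t g} & (a * B < size s')%N].
  apply: contrapT => no; move: aaB; rewrite ltnNge => /negP; apply.
  apply: leq_trans (_ : size T1 * (a * B) <= _)%N; last by rewrite leq_mul2r Ta orbT.
  apply: (pigeonhole_cover (P := E)) => //; first exact: fset_uniq.
  move=> t tT s' us' s's s'E; rewrite leqNgt; apply/negP => big; apply: no.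
  by exists t => //; exists s'.
pose L2 := [seq (t^-1 * g * c)%g | g <- s'].
have uL2 : uniq L2 by rewrite map_inj_uniq // => g g' /mulIg /mulgI.
have [T2 [uT2 T2s T2E T2c]] := exists_transversal Er Es uL2.
exists T2; split => //.
  move=> _ /T2s /mapP[g /s's gS ->]; apply: (@word_ballM _ _ 2 1); last exact: word_ball_gen.
  by apply: (@word_ballM _ _ 1 1); apply: word_ball_gen => //; apply: SV; exact: T1s.
have : (a * B < size T2 * B)%N.
  apply: leq_trans aB _; rewrite -(size_map (fun g => (t^-1 * g * c)%g)).
  apply: (pigeonhole_cover (P := E)) => // u uT s'' us'' s''s s''E.
  (* Sends the elements in the coset of [u] into the intersection of [E] and its conjugate by
     [c]. *)
  pose f v := (c * u^-1 * v * c^-1)%g.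
  have fI : injective f by move=> v v' /mulIg /mulgI.
  rewrite -ltnS -(ltr_nat R); apply: le_lt_trans B2; rewrite -(size_map f).
  apply: (count_elementary W nc); first by rewrite map_inj_uniq.
  move=> _ /mapP[v vs ->]; split; last first.
    have -> : (c^-1 * f v * c = u^-1 * v)%g by rewrite /f !mulgA mulVg mul1g mulgVK.
    exact: s''E.
  have /mapP[g gs' vE] := s''s v vs; have /mapP[g' gs'' uE] := T2s u uT.
  have -> : f v = ((t^-1 * g')^-1 * (t^-1 * g))%g.
    by rewrite /f vE uE !invgM !invgK !mulgA mulgV mul1g mulgK.
  by apply: elementaryM; [apply: elementaryV|]; exact: s'E.
by rewrite ltn_mul2r => /andP[].
Qed.

(** A kernel of fewer than [k] elements splits [T] into [3 * (k - 1)] classes at most, and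
    [3 * (k - 1) * (k + 1) < 3 * k ^ 2], so one has at least [k + 2] members. The two nearest axes
    become [t1] and [t2] of [pingpong_chain], the others [J]. *)
Lemma exists_free k (T : seq G) : (0 < k)%N -> uniq T -> {in T, forall g, word_ball S 3 g} ->
  {in T &, forall g g', g != g' -> ~ elementary h (g^-1 * g')%g} -> (3 * k ^ 2 < size T)%N ->
  exists U : seq G, [/\ uniq U, free_on U, {in U, forall g, word_ball S (12 + 2 * (M * N)) g} &
    (k <= size U)%N].
Proof.
move=> k0 uT T3 Tn Tk; have [SV _] := Sgen.
have l12 : ((6 + M * N) + (6 + M * N) <= 12 + 2 * (M * N))%N by lia.
have twist_ball b t : word_ball S 3 t -> word_ball S (6 + M * N) (conj_power h N b t).
  move=> t3; have -> : (6 + M * N = 3 + M * N + 3)%N by lia.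
  apply: word_ballM; last exact: word_ballV.
  apply: word_ballM => //; case: b; first exact: word_ballX.
  by rewrite -(hpowV h true); apply: word_ballV => //; exact: word_ballX.
have [ o [_ [_ _ _ _ _]]] := far_points W 0.
pose Q g g' := exists b, H / 4 <= `|xc g (act (conj_power h N b g') o) - xc g o|.
have [L [uL LT LQ Lc]] := @exists_kernel R G (fun t => yc t o) Q T uT.
have [kL|Lk] := leqP k (size L).
  exists (map (conj_power h N true) L); rewrite size_map.
  have [|uU freeU] := pingpong_antichain W H4 HP (o := o) uL.
    have nQ g g' : ~ Q g g' -> forall b, `|xc g (act (conj_power h N b g') o) - xc g o| < H / 4.
      by move=> nq b; rewrite ltNge; apply/negP => ?; apply: nq; exists b.
    by move=> far g g' gL g'L /(LQ _ _ gL g'L)[[? /nQ ?]|[? /nQ ?]]; [left|right].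
  split => // _ /mapP[t tL ->]; apply: word_ball_le (twist_ball true t (T3 _ (LT _ tL))).
  by lia.
pose P (i : G * option bool) (g : G) : Prop := match i.2 with
  | Some b => is_true (H / 4 <= `|xc g (act (conj_power h N b i.1) o) - xc g o|)
  | None => g = i.1 end.
pose J := [seq (l, ob) | l <- L, ob <- [:: None; Some true; Some false]].
have [[l [b|]] _ [s [us sT sP sk]]] : exists2 i, i \in J & exists s : seq G,
    [/\ uniq s, {subset s <= T}, {in s, forall g, P i g} & (k.+1 < size s)%N]; last 1 first.
- case: s us sT sP sk => [|g [|g' s]] //= us _ sP _; move: us.
  rewrite (sP g) ?mem_head // (sP g') ?inE ?eqxx ?orbT //.
- apply: contrapT => no.
  have : (size T <= size J * k.+1)%N.
    apply: (pigeonhole_cover (P := P)) => //.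
      move=> g /Lc[gL|[l lL [b Qb]]].
        by exists (g, None) => //; apply/allpairsP; exists (g, None).
      by exists (l, Some b) => //; apply/allpairsP; exists (l, Some b); split => //; case: (b).
    move=> i iJ s' us' s'T s'P; rewrite leqNgt; apply/negP => big; apply: no.
    by exists i => //; exists s'.
  rewrite size_allpairs /= => TJ.
  have : (size L * 3 * k.+1 <= k.-1 * 3 * k.+1)%N.
    by rewrite !leq_mul2r; apply/orP; right; apply/orP; right; lia.
  by move: Tk TJ; rewrite -mulnn; clear -k0; case: k k0 => // k' _ /=; nia.
set q := act (conj_power h N b l) o in sP.
pose le (g g' : G) := yc g o <= yc g' o.
have le_tr : transitive le by move=> g1 g2 g3; exact: le_trans.
have le_tot : total le by move=> g1 g2; exact: le_total.
have := sort_sorted le_tot s; have := size_sort le s; have := sort_uniq le s.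
have := mem_sort le s; case: (sort le s) => [|t1 [|t2 K]] mems uK sizeK; rewrite -sizeK // in sk.
move=> /= /andP[t12 t2K]; rewrite us /= in uK.
have sub z : z \in t1 :: t2 :: K -> z \in T by rewrite mems => /sT.
have t1m : t1 \in t1 :: t2 :: K by rewrite mem_head.
have t2m : t2 \in t1 :: t2 :: K by rewrite !inE eqxx orbT.
have Km z : z \in K -> z \in t1 :: t2 :: K by move=> zK; rewrite !inE zK !orbT.
move: uK; rewrite inE negb_or => /andP[/andP[n12 _] /andP[n2K uK]].
pose w t := (conj_power h N (~~ (xc t o <= xc t q)) t * conj_power h N true t1)%g.
have [||||||uU freeU] := @pingpong_chain _ _ _ _ _ _ _ _ _ _ _ N W H4 HP o q t1 t2 K uK.
- by move=> z zK; apply: sP; rewrite -mems.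
- exact: t12.
- by apply/allP; exact: order_path_min t2K.
- by apply: Tn => //; exact: sub.
- move=> z zK; apply: Tn; [exact: sub|exact/sub/Km|].
  by apply: contraNneq n2K => ->.
- by move=> z z' /Km/sub zT /Km/sub z'T; exact: Tn.
exists (map w K); split; [exact: uU|exact: freeU| |by rewrite size_map; exact: sk].
move=> g /mapP[t tK gE].
apply: word_ball_le l12 _.
rewrite gE.
apply: word_ballM.
  apply: twist_ball; apply: T3; apply: sub.
  exact: Km.
apply: twist_ball; apply: T3; apply: sub; exact: t1m.
Qed.

End Assembly.

(** * Numerical estimates and conclusion *)

(** [B] is the inverse of [A]; [288] is [16 * 18], and the last bound is four times the length of
    the generators, the exponent of [|S|] being divided by 4. *)
Lemma denominator_bounds (R : realType) (M D : R) : 1 <= M -> 50 <= D ->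
  let B := (79 * 1000 + 220) * M * D ^+ 3 in
  [/\ 1 <= B, 288 * D <= B & 4 * (12 + 2 * (M * (1000 * D + 1))) <= B].
Proof.
move=> M1 D50 B.
have MD : D <= M * D by rewrite ler_peMl //; lra.
have MM : M <= M * D by rewrite ler_peMr //; lra.
have D2 : 2500 <= D ^+ 2.
  have : 50 * 50 <= D * D by apply: ler_pM; lra.
  by rewrite expr2; lra.
have BD : (79 * 1000 + 220) * 2500 * (M * D) <= B.
  have -> : B = (79 * 1000 + 220) * D ^+ 2 * (M * D) by rewrite /B; ring.
  by apply: ler_wpM2r; lra.
by split; lra.
Qed.

(** For the largest possible [k], the factor [16] comes from [k + 1 <= 2 * k]. *)
Lemma exists_fourth_root (R : realType) (c : R) (m : nat) : 1 <= c -> c < m%:R ->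
  exists k : nat, [/\ (0 < k)%N, c * k%:R ^+ 4 < m%:R & m%:R <= 16 * c * k%:R ^+ 4].
Proof.
move=> c1 cm; pose P k := c * k%:R ^+ 4 < m%:R.
have P1 : P 1%N by rewrite /P expr1n mulr1.
have Pm k : P k -> (k <= m)%N.
  rewrite /P => km; rewrite -(ler_nat R); apply: le_trans (ltW km).
  case: k {km} => [|k]; first by rewrite expr0n mulr0.
  apply: le_trans (_ : k.+1%:R ^+ 4 <= _); last by rewrite ler_peMl ?exprn_ge0.
  by rewrite -{1}[k.+1%:R]expr1 ler_weXn2l ?ler1n.
case: (ex_maxnP (ex_intro P 1%N P1) Pm) => k Pk kmax; exists k; split => //; first exact: kmax.
have k0 : (0 < k)%N by exact: kmax.
have : ~~ P k.+1 by apply/negP => /kmax; rewrite ltnn.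
rewrite /P -leNgt => mk; apply: le_trans mk _.
have -> : 16 * c * k%:R ^+ 4 = c * (2 * k%:R) ^+ 4 by ring.
apply: ler_wpM2l; first lra.
rewrite ler_pXn2r ?nnegrE // ?mulr_ge0 // -natrM ler_nat mul2n -addnn -addn1.
by rewrite leq_add2l.
Qed.

Lemma root_bound (R : realType) (A c : R) (m k l : nat) : 0 < A -> A <= 1 -> 1 <= c -> A * c <= 1 ->
  (0 < k)%N -> 4 * A <= l%:R^-1 -> m%:R <= c * k%:R ^+ 4 ->
  A * m%:R `^ A <= k%:R `^ l%:R^-1.
Proof.
move=> A0 A1 c1 Ac k0 A4 mk; have c0 : 0 <= c := le_trans ler01 c1.
have k4 : 0 <= k%:R ^+ 4 :> R by rewrite exprn_ge0.
have mA : m%:R `^ A <= c * k%:R `^ l%:R^-1.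
  apply: le_trans (_ : (c * k%:R ^+ 4) `^ A <= _).
    by apply: ge0_ler_powR mk; rewrite ?nnegrE ?mulr_ge0 // ltW.
  rewrite powRM //; apply: ler_pM; rewrite ?powR_ge0 //.
    by apply: le_trans (ler_powR c1 A1) _; rewrite powRr1.
  by rewrite -powR_mulrn // -powRrM; apply: ler_powR; rewrite // ler1n.
apply: le_trans (ler_wpM2l (ltW A0) mA) _.
by rewrite mulrA ler_piMl ?powR_ge0.
Qed.

Theorem proposition2p10 (R : realType) (delta : R) (X : metricType R)
    (G : groupType) (act : G -> X -> X) (D : R -> R) (M : nat)
    (delta_gt0 : 0 < delta)
    (X_hyp : hyperbolic_space X delta)
    (G_act : isometric_action act)
    (G_graph : acts_on_graph act)
    (G_nvc : ~ virtually_cyclic G)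
    (D_wpd : wpd_function delta D)
    (M_gt0 : (0 < M)%N)
    (S_wpd : forall S : {fset G}, generating S ->
       exists2 h : G, word_ball S M h & wpd act delta D h) :
  let A : R := 1 / ((79 * 1000 + 220) * M%:R * D (200 * delta) ^+ 3) in
  0 < A /\
  forall S : {fset G}, generating S -> A * #|` S|%:R `^ A <= growth_rate R S.
Proof.
move=> A; set D2 := D (200 * delta) in A *.
have D50 : 50 <= D2.
  by have [_ Dm D1] := D_wpd; apply: le_trans D1 (Dm _ _ _ _); lra.
have M1 : 1 <= M%:R :> R by rewrite ler1n.
have [B1 B288 Blen] := denominator_bounds M1 D50.
set B := (_ * _ * _) in A B1 B288 Blen *.
have AE : A = B^-1 by rewrite /A div1r.
have B0 : 0 < B by lra.
have A0 : 0 < A by rewrite AE invr_gt0.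
split => // S Sgen; set m := #|` S|.
have [h hM [h_hyp [gam h_axis few]]] := S_wpd S Sgen.
have [x [y ax]] := axis_coordinates_exist delta_gt0 X_hyp G_act h_hyp h_axis.
have W := WpdAxis delta_gt0 h_hyp G_act ax few.
have H4 := hyperbolic_four_point X_hyp.
have [N' /andP[N1 N2]] : exists n : nat, n%:R <= 1000 * D2 < n.+1%:R.
  by apply: nat_floor; lra.
pose N := N'.+1; pose l := (12 + 2 * (M * N))%N.
have HP : 1000 * (D2 * translation_length act h) <= N%:R * translation_length act h.
  by rewrite mulrA ler_pM2r // ltW.
have lB : 4 * l%:R <= B.
  apply: le_trans Blen; rewrite /l natrD !natrM.
  have : M%:R * N%:R <= M%:R * (1000 * D2 + 1) :> R.
    by apply: ler_wpM2l; rewrite // /N -natr1; lra.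
  lra.
have gr k : (0 < k)%N -> 18 * D2 * k%:R ^+ 4 < m%:R -> k%:R `^ l%:R^-1 <= growth_rate R S.
  move=> k0 mk; have [T [uT T3 Tn Tk]] := exists_lines W Sgen G_nvc mk.
  have [U [uU freeU Ul kU]] := exists_free W H4 Sgen hM HP k0 uT T3 Tn Tk.
  by apply: growth_rate_ge => //; exact: free_on_ball_size uU freeU Ul kU.
have gr1 : 1 <= growth_rate R S.
  have := @growth_rate_ge G S R 1 1 isT; rewrite powR1; apply => n.
  by rewrite exp1n ball_size_gt0.
have l0 : 0 < l%:R :> R by rewrite ltr0n.
have AB : A * B = 1 by rewrite AE mulVf // gt_eqF.
have A1 : A <= 1 by rewrite AE invf_le1.
have A4 : 4 * A <= l%:R^-1 by rewrite AE ler_pdivrMr // mulrC ler_pdivlMr.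
have D18 : 1 <= 18 * D2 by lra.
have c_ge1 : 1 <= 16 * (18 * D2) by lra.
have Ac : A * (16 * (18 * D2)) <= 1 by rewrite -[X in _ <= X]AB ler_pM2l //; lra.
(* For small [S] the bound is at most 1, which is [root_bound] with [k = 1]. *)
have [small|large] := lerP m%:R (18 * D2).
  have m_le : m%:R <= 16 * (18 * D2) * 1%:R ^+ 4 by rewrite expr1n; lra.
  apply: le_trans (root_bound A0 A1 c_ge1 Ac (ltn0Sn 0) A4 m_le) _.
  by rewrite powR1.
have [k [k0 km mk]] := exists_fourth_root D18 large.
exact: le_trans (root_bound A0 A1 c_ge1 Ac k0 A4 mk) (gr k k0 km).
Qed.
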